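(* Let $\mathbb{F}$ be a field, let $n$ be a positive integer with prime factorization $n=p_1^{s_1}p_2^{s_2}\cdots p_k^{s_k}$ for distinct primes $p_1,\dots,p_k$, and let $P$ be the ranked poset of (positive) factors of $n$, ordered by divisibility. Suppose $\sigma$ is a permutation of $\{p_1,\dots,p_k\}$ that maps each prime to a prime appearing with the same multiplicity in the factorization of $n$, acting on $P$ by permuting the primes. Let $\sigma$ have cycle decomposition $\sigma_1\sigma_2\cdots\sigma_r$ (including cycles of length $1$), where $\sigma_j$ has length $i_j$ and permutes primes that appear with multiplicity $m_j$ in $n$. Then the graded trace generating function of the automorphism of the splitting algebra $A(P)$ over $\mathbb{F}$ induced by $\sigma$ is $$Tr_\sigma(A(P),z)=\frac{1-z}{1-z\prod_{j=1}^r\left(1+m_j\left(1-z^{i_j}\right)\right)}.$$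
   Context: The rank of a factor $m$ of $n$ is $\Omega(m)$, the number of prime factors of $m$ counted with multiplicity. The action of $\sigma$ on $P$ is $\prod_i p_i^{a_i}\mapsto\prod_i\sigma(p_i)^{a_i}$, a poset automorphism. In a poset, $p\lessdot q$ ($q$ covers $p$) means $p<q$ and any $r$ with $p\leq r\leq q$ equals $p$ or $q$. Splitting algebra: for a finite ranked poset $P$ (a poset with rank function such that rank $0$ means minimal and covers increase rank by exactly $1$), the Hasse diagram is the directed graph with vertex set $P$ and edge set $E_P=\{(q,p):p\lessdot q\}$; the edge $e=(q,p)$ has tail $t(e)=q$ and head $h(e)=p$. A path is a tuple $\pi=(e_1,\dots,e_m)$ of edges with $h(e_i)=t(e_{i+1})$ for $1\leq i<m$; put $t(\pi)=t(e_1)$, $h(\pi)=h(e_m)$. Write $\pi_1\approx\pi_2$ if $t(\pi_1)=t(\pi_2)$ and $h(\pi_1)=h(\pi_2)$. Let $\mathbb{F}\langle E_P\rangle$ be the free associative unital algebra on $E_P$. To each path $\pi=(e_1,\dots,e_m)$ associate the polynomial $(t-e_1)(t-e_2)\cdots(t-e_m)=\sum_{i\geq 0}e(\pi,i)t^i$ in $\mathbb{F}\langle E_P\rangle[t]$, with $t$ a central variable. Then $A(P)=\mathbb{F}\langle E_P\rangle/R$, where $R$ is the two-sided ideal generated by all $e(\pi_1,i)-e(\pi_2,i)$ with $\pi_1\approx\pi_2$ and $i\geq 0$. The ideal $R$ is homogeneous, so $A(P)$ inherits a grading in which every edge has degree $1$. An automorphism $\sigma$ of the poset $P$ permutes the edges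 of the Hasse diagram and so induces a graded algebra automorphism of $A(P)$, also called $\sigma$. For a graded automorphism $\sigma$ of $A=\bigoplus_{i\geq0}A_i$ (with finite-dimensional pieces), the graded trace generating function is $Tr_\sigma(A,z)=\sum_{i\geq0}Tr(\sigma|_{A_i})z^i$. The claimed identity is one of formal power series over $\mathbb{F}$, with integer coefficients mapped into $\mathbb{F}$. *)

(* Defs.v *)
From HB Require Import structures.
From mathcomp Require Import all_boot all_order all_fingroup all_algebra.
From mathcomp Require Import finmap.
From mathcomp.multinomials Require Import monalg.
From mathcomp Require Import boolp generic_quotient.

Set Implicit Arguments.
Unset Strict Implicit.
Unset Printing Implicit Defensive.

Import Order.TTheory GRing.Theory.
Local Open Scope ring_scope.

Section Cover.
Variables (d : Order.disp_t) (P : finPOrderType d).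
Local Open Scope order_scope.

(* q covers p *)
Definition covers (q p : P) : bool :=
  (p < q) && [forall r : P, (p <= r <= q) ==> (r == p) || (r == q)].

End Cover.

HB.mixin Record FinPOrder_isRanked d P of Order.FinPOrder d P := {
  rank : P -> nat;
  rank_minimal : forall p : P,
    rank p = 0%N <-> (forall q : P, (q <= p)%O -> q = p);
  rank_covers : forall q p : P, covers q p -> rank q = (rank p).+1
}.

#[short(type="finRankedPOrderType")]
HB.structure Definition FinRankedPOrder d :=
  {P of FinPOrder_isRanked d P & Order.FinPOrder d P}.

Section Hasse.
Variables (d : Order.disp_t) (P : finPOrderType d).

Definition hasse_edge := {e : P * P | covers e.1 e.2}.

HB.instance Definition _ := Finite.on hasse_edge.

Implicit Types (e f : hasse_edge) (s : seq hasse_edge).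

Definition edge_tail e : P := (val e).1.
Definition edge_head e : P := (val e).2.

(* The path (e, s_1, ..., s_k) is represented by its first edge and the *)
(* sequence of the others; in particular paths are nonempty.            *)
Definition hasse_path e s : bool :=
  path (fun f g => edge_head f == edge_tail g) e s.

Definition path_equiv e1 s1 e2 s2 : Prop :=
  edge_tail e1 = edge_tail e2 /\
  edge_head (last e1 s1) = edge_head (last e2 s2).

End Hasse.

Section TwoSidedIdeal.
Variables (T : pzRingType) (G : T -> Prop).

Inductive two_sided_ideal : T -> Prop :=
| ideal_gen x : G x -> two_sided_ideal x
| ideal_zero : two_sided_ideal 0
| ideal_add x y :
    two_sided_ideal x -> two_sided_ideal y -> two_sided_ideal (x + y)
| ideal_mull a x : two_sided_ideal x -> two_sided_ideal (a * x)
| ideal_mulr a x : two_sided_ideal x -> two_sided_ideal (x * a).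

End TwoSidedIdeal.

Section SplittingAlgebra.
Variables (F : fieldType) (d : Order.disp_t) (P : finRankedPOrderType d).
Local Notation E := (hasse_edge P).

(* The monoid algebra of the free monoid on E is the free algebra on E. *)
Definition free_alg := {malg F[{fmonom E}]}.
HB.instance Definition _ := GRing.Lalgebra.on free_alg.

Definition free_gen (e : E) : free_alg := << fmu e >>.

Lemma free_scalerAr (k : F) (x y : free_alg) : k *: (x * y) = x * (k *: y).
Proof.
suff H (z : free_alg) : z * malgC k = k *: z.
  by rewrite -H -mulrA H.
rewrite malgM_def fgmulgU malgZ_def /fgscale.
by apply: eq_bigr => w _; rewrite mulm1 mulrC.
Qed.

HB.instance Definition _ :=
  GRing.Lalgebra_isAlgebra.Build F free_alg free_scalerAr.

Definition path_poly (s : seq E) : {poly free_alg} :=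
  \prod_(e <- s) ('X - (free_gen e)%:P).

Definition splitting_relator (g : free_alg) : Prop :=
  exists e1 s1 e2 s2 i,
    [/\ hasse_path e1 s1, hasse_path e2 s2, path_equiv e1 s1 e2 s2
      & g = (path_poly (e1 :: s1))`_i - (path_poly (e2 :: s2))`_i].

Definition splitting_ideal : {pred free_alg} :=
  fun g => `[< two_sided_ideal splitting_relator g >].

Lemma splitting_idealP g :
  reflect (two_sided_ideal splitting_relator g) (g \in splitting_ideal).
Proof. exact: asboolP. Qed.

Lemma splitting_ideal_zmod_closed : zmod_closed splitting_ideal.
Proof.
split=> [|x y /splitting_idealP xI /splitting_idealP yI].
  exact/splitting_idealP/ideal_zero.
apply/splitting_idealP/ideal_add => //.
by rewrite -mulN1r; apply: ideal_mull.
Qed.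

HB.instance Definition _ :=
  GRing.isZmodClosed.Build free_alg splitting_ideal
    splitting_ideal_zmod_closed.

Lemma splitting_idealMl a x :
  x \in splitting_ideal -> a * x \in splitting_ideal.
Proof.
by move=> /splitting_idealP xI; apply/splitting_idealP/ideal_mull.
Qed.

Lemma splitting_idealMr a x :
  x \in splitting_ideal -> x * a \in splitting_ideal.
Proof.
by move=> /splitting_idealP xI; apply/splitting_idealP/ideal_mulr.
Qed.

Lemma splitting_idealZ (k : F) x :
  x \in splitting_ideal -> k *: x \in splitting_ideal.
Proof. by move=> xI; rewrite -mul_malgC; apply: splitting_idealMl. Qed.

Lemma hasse_path_rank (e : E) s : hasse_path e s ->
  rank (edge_tail e) = (rank (edge_head (last e s)) + (size s).+1)%N.
Proof.
elim: s e => [|f s IHs] e /=.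
  by move=> _; rewrite addn1; exact: rank_covers (valP e).
move=> /andP[/eqP ef fs]; rewrite addnS -(IHs f fs) -ef.
exact: rank_covers (valP e).
Qed.

Lemma path_poly_aug s i : ((path_poly s)`_i)@_mone = (i == size s)%:R :> F.
Proof.
transitivity ((map_poly (@mcoeff _ F (mone : {fmonom E})) (path_poly s))`_i).
  by rewrite coef_map.
rewrite rmorph_prod /= (eq_bigr (fun=> 'X)).
  by rewrite big_const_seq count_predT iter_mulr_1 coefXn.
move=> e _; rewrite rmorphB /= map_polyX map_polyC /=.
by rewrite mcoeffU1 fm1_eq1 subr0.
Qed.

Lemma splitting_ideal_aug g : g \in splitting_ideal -> g@_mone = 0.
Proof.
move=> /splitting_idealP; elim=> {g}.
- move=> _ [e1 [s1 [e2 [s2 [i [p1 p2 [eqt eqh] ->]]]]]].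
  rewrite mcoeffB !path_poly_aug /=.
  move: (hasse_path_rank p1); rewrite eqt eqh (hasse_path_rank p2).
  by move/eqP; rewrite eqn_add2l => /eqP ->; rewrite subrr.
- exact: mcoeff0.
- by move=> x y _ x0 _ y0; rewrite mcoeffD x0 y0 addr0.
- by move=> a x _ x0; rewrite rmorphM /= x0 mulr0.
- by move=> a x _ x0; rewrite rmorphM /= x0 mul0r.
Qed.

Local Open Scope quotient_scope.

Definition splitting_alg := Quotient.quot splitting_ideal.

HB.instance Definition _ := GRing.Zmodule.on splitting_alg.
HB.instance Definition _ := EqQuotient.on splitting_alg.

Definition splitting_pi (g : free_alg) : splitting_alg := \pi_splitting_alg g.

Lemma splitting_piP g h :
  reflect (splitting_pi g = splitting_pi h) (g - h \in splitting_ideal).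
Proof. by rewrite Quotient.idealrBE; apply: eqP. Qed.

Lemma splitting_pi_repr x : splitting_pi (repr x) = x.
Proof. exact: reprK. Qed.

Lemma splitting_pi_surj x : exists g, x = splitting_pi g.
Proof. by exists (repr x); rewrite splitting_pi_repr. Qed.

Lemma splitting_piB : {morph splitting_pi : g h / g - h}.
Proof. by move=> g h; rewrite /splitting_pi raddfB. Qed.

Lemma splitting_piD : {morph splitting_pi : g h / g + h}.
Proof. by move=> g h; rewrite /splitting_pi raddfD. Qed.

Definition splitting_one : splitting_alg := splitting_pi 1.
Definition splitting_mul (x y : splitting_alg) : splitting_alg :=
  splitting_pi (repr x * repr y).
Definition splitting_scale (k : F) (x : splitting_alg) : splitting_alg :=
  splitting_pi (k *: repr x).

Lemma repr_splitting_pi g : repr (splitting_pi g) - g \in splitting_ideal.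
Proof. by apply/splitting_piP; rewrite splitting_pi_repr. Qed.

Lemma splitting_piM_def g h :
  splitting_pi (g * h) = splitting_mul (splitting_pi g) (splitting_pi h).
Proof.
apply/esym/splitting_piP.
set g' := repr _; set h' := repr _.
have -> : g' * h' - g * h = g' * (h' - h) + (g' - g) * h.
  by rewrite mulrBr mulrBl addrA subrK.
apply: (@rpredD _ splitting_ideal).
  exact/splitting_idealMl/repr_splitting_pi.
exact/splitting_idealMr/repr_splitting_pi.
Qed.

Lemma splitting_piZ_def k g :
  splitting_pi (k *: g) = splitting_scale k (splitting_pi g).
Proof.
apply/esym/splitting_piP.
rewrite -scalerBr; exact/splitting_idealZ/repr_splitting_pi.
Qed.

Lemma splitting_mulA : associative splitting_mul.
Proof.
move=> x y z; case: (splitting_pi_surj x) => g ->.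
case: (splitting_pi_surj y) => h ->; case: (splitting_pi_surj z) => k ->.
by rewrite -!splitting_piM_def mulrA.
Qed.

Lemma splitting_mul1r : left_id splitting_one splitting_mul.
Proof.
by move=> x; case: (splitting_pi_surj x) => g ->; rewrite -splitting_piM_def mul1r.
Qed.

Lemma splitting_mulr1 : right_id splitting_one splitting_mul.
Proof.
by move=> x; case: (splitting_pi_surj x) => g ->; rewrite -splitting_piM_def mulr1.
Qed.

Lemma splitting_mulDl : left_distributive splitting_mul +%R.
Proof.
move=> x y z; case: (splitting_pi_surj x) => g ->.
case: (splitting_pi_surj y) => h ->; case: (splitting_pi_surj z) => k ->.
by rewrite -splitting_piD -!splitting_piM_def -splitting_piD mulrDl.
Qed.

Lemma splitting_mulDr : right_distributive splitting_mul +%R.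
Proof.
move=> x y z; case: (splitting_pi_surj x) => g ->.
case: (splitting_pi_surj y) => h ->; case: (splitting_pi_surj z) => k ->.
by rewrite -splitting_piD -!splitting_piM_def -splitting_piD mulrDr.
Qed.

Lemma splitting_one_neq0 : splitting_one != 0.
Proof.
apply/eqP => eq10; have: (1 : free_alg) - 0 \in splitting_ideal.
  by apply/splitting_piP; rewrite -/splitting_one eq10 /splitting_pi raddf0.
rewrite subr0 => /splitting_ideal_aug /eqP.
by rewrite mcoeff1 eqxx oner_eq0.
Qed.

HB.instance Definition _ := GRing.Zmodule_isNzRing.Build splitting_alg
  splitting_mulA splitting_mul1r splitting_mulr1 splitting_mulDl
  splitting_mulDr splitting_one_neq0.

Lemma splitting_scaleA (a b : F) x :
  splitting_scale a (splitting_scale b x) = splitting_scale (a * b) x.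
Proof.
by case: (splitting_pi_surj x) => g ->; rewrite -!splitting_piZ_def scalerA.
Qed.

Lemma splitting_scale1 : left_id 1 splitting_scale.
Proof.
by move=> x; case: (splitting_pi_surj x) => g ->; rewrite -splitting_piZ_def scale1r.
Qed.

Lemma splitting_scaleDr : right_distributive splitting_scale +%R.
Proof.
move=> a x y; case: (splitting_pi_surj x) => g ->.
case: (splitting_pi_surj y) => h ->.
by rewrite -splitting_piD -!splitting_piZ_def -splitting_piD scalerDr.
Qed.

Lemma splitting_scaleDl x : {morph splitting_scale^~ x : a b / a + b}.
Proof.
move=> a b; case: (splitting_pi_surj x) => g ->.
by rewrite -!splitting_piZ_def -splitting_piD scalerDl.
Qed.

HB.instance Definition _ := GRing.Zmodule_isLmodule.Build F splitting_alg
  splitting_scaleA splitting_scale1 splitting_scaleDr splitting_scaleDl.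

Lemma splitting_piM : {morph splitting_pi : g h / g * h}.
Proof. exact: splitting_piM_def. Qed.

Lemma splitting_piZ k : {morph splitting_pi : g / k *: g}.
Proof. by move=> g; exact: splitting_piZ_def. Qed.

Lemma splitting_scalerAl (k : F) (x y : splitting_alg) :
  k *: (x * y) = (k *: x) * y.
Proof.
case: (splitting_pi_surj x) => g ->; case: (splitting_pi_surj y) => h ->.
by rewrite -splitting_piM -!splitting_piZ -splitting_piM scalerAl.
Qed.

Lemma splitting_scalerAr (k : F) (x y : splitting_alg) :
  k *: (x * y) = x * (k *: y).
Proof.
case: (splitting_pi_surj x) => g ->; case: (splitting_pi_surj y) => h ->.
by rewrite -splitting_piM -!splitting_piZ -splitting_piM scalerAr.
Qed.

HB.instance Definition _ :=
  GRing.Lmodule_isLalgebra.Build F splitting_alg splitting_scalerAl.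
HB.instance Definition _ :=
  GRing.Lalgebra_isAlgebra.Build F splitting_alg splitting_scalerAr.

HB.instance Definition _ :=
  GRing.isZmodMorphism.Build free_alg splitting_alg splitting_pi splitting_piB.
HB.instance Definition _ :=
  GRing.isMonoidMorphism.Build free_alg splitting_alg splitting_pi
    (conj (erefl _) splitting_piM).
HB.instance Definition _ :=
  GRing.isScalable.Build F free_alg splitting_alg *:%R splitting_pi
    splitting_piZ.

Definition splitting_gen (e : E) : splitting_alg := splitting_pi (free_gen e).

Definition free_homog (i : nat) (g : free_alg) : Prop :=
  forall w : {fmonom E}, g@_w != 0 -> fdeg w = i.

Definition splitting_piece (i : nat) (x : splitting_alg) : Prop :=
  exists2 g, free_homog i g & x = splitting_pi g.

End SplittingAlgebra.

Arguments splitting_ideal F {d} P _ : rename.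
Arguments splitting_piece F {d} P i x : rename.

Section PosetAut.
Variables (d : Order.disp_t) (P : finPOrderType d).

Record poset_aut := PosetAut {
  poset_aut_perm :> {perm P};
  poset_autP : {mono poset_aut_perm : x y / (x <= y)%O}
}.

Variable s : poset_aut.

Lemma poset_aut_covers q p : covers (s q) (s p) = covers q p.
Proof.
have lts x y : (s x < s y)%O = (x < y)%O.
  by rewrite !lt_neqAle poset_autP (inj_eq perm_inj).
rewrite /covers lts; congr (_ && _); apply/forallP/forallP => H r.
  by have := H (s r); rewrite !poset_autP !(inj_eq perm_inj).
rewrite -(permKV s r); have := H ((poset_aut_perm s)^-1%g r).
by rewrite !poset_autP !(inj_eq perm_inj).
Qed.

Definition edge_aut (e : hasse_edge P) : hasse_edge P :=
  Sub (s (edge_tail e), s (edge_head e))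
    (etrans (poset_aut_covers (edge_tail e) (edge_head e)) (valP e)).

Lemma edge_tail_aut e : edge_tail (edge_aut e) = s (edge_tail e).
Proof. by []. Qed.

Lemma edge_head_aut e : edge_head (edge_aut e) = s (edge_head e).
Proof. by []. Qed.

Lemma edge_aut_inj : injective edge_aut.
Proof.
move=> e f /(congr1 val) [/perm_inj et /perm_inj eh].
by apply: val_inj; rewrite [LHS]surjective_pairing [RHS]surjective_pairing; congr pair.
Qed.

Lemma hasse_path_aut e t :
  hasse_path (edge_aut e) (map edge_aut t) = hasse_path e t.
Proof.
rewrite /hasse_path path_map; apply: eq_path => f g /=.
by rewrite edge_head_aut edge_tail_aut (inj_eq perm_inj).
Qed.

End PosetAut.

Section InducedAut.
Variables (F : fieldType) (d : Order.disp_t) (P : finRankedPOrderType d).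
Variable s : poset_aut P.
Local Notation E := (hasse_edge P).
Local Notation T := (free_alg F P).
Local Notation A := (splitting_alg F P).

Definition word_aut (w : {fmonom E}) : T :=
  << FMonom (map (edge_aut s) w) >>.

Lemma word_aut_mmorphism : mmorphism word_aut.
Proof.
split=> [v w|]; rewrite /word_aut.
  rewrite malgM_def fgmulUU mulr1; congr << 1 *g _ >>; apply: val_inj.
  by rewrite /= !fmM /= map_cat.
by congr << 1 *g _ >>; apply: val_inj; rewrite /= fm1.
Qed.

HB.instance Definition _ :=
  isMultiplicative.Build {fmonom E} T word_aut word_aut_mmorphism.

Definition free_aut (g : T) : T := mmap (@malgC {fmonom E} F) word_aut g.

Lemma free_aut_zmod_morphism : zmod_morphism free_aut.
Proof. exact: mmap_is_additive. Qed.

HB.instance Definition _ :=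
  GRing.isZmodMorphism.Build T T free_aut free_aut_zmod_morphism.

Lemma free_aut_monoid_morphism : monoid_morphism free_aut.
Proof.
have comm_malgC (g : {malg F[{fmonom E}]}) (v w : {fmonom E}) :
    GRing.comm (malgC g@_v : T) (word_aut w).
  rewrite /GRing.comm [LHS]mul_malgC -[word_aut w in LHS]mulr1.
  by rewrite free_scalerAr -[_ *: 1 in LHS]mul_malgC [_ * 1]mulr1.
have [mmapM mmap1'] := commr_mmap_is_multiplicative comm_malgC.
by split.
Qed.

HB.instance Definition _ :=
  GRing.isMonoidMorphism.Build T T free_aut free_aut_monoid_morphism.

Lemma free_autZ k : {morph free_aut : g / k *: g}.
Proof. by move=> g; rewrite /free_aut mmapZ mul_malgC. Qed.

HB.instance Definition _ :=
  GRing.isScalable.Build F T T *:%R free_aut free_autZ.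

Lemma free_aut_gen e : free_aut (free_gen F e) = free_gen F (edge_aut s e).
Proof.
rewrite /free_aut mmapU mul1r /word_aut /free_gen.
by congr << 1 *g _ >>; apply: val_inj; rewrite /= !fmU.
Qed.

Lemma map_path_poly t :
  map_poly free_aut (path_poly F t) = path_poly F (map (edge_aut s) t).
Proof.
rewrite /path_poly rmorph_prod big_map; apply: eq_bigr => e _ /=.
by rewrite rmorphB /= map_polyX map_polyC /= free_aut_gen.
Qed.

Lemma free_aut_coef_path_poly t i :
  free_aut (path_poly F t)`_i = (path_poly F (map (edge_aut s) t))`_i.
Proof. by rewrite -map_path_poly coef_map. Qed.

Lemma free_aut_ideal g :
  g \in splitting_ideal F P -> free_aut g \in splitting_ideal F P.
Proof.
move=> /splitting_idealP gI; apply/splitting_idealP.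
elim: gI => {g} [_ [e1 [s1 [e2 [s2 [i [p1 p2 [eqt eqh] ->]]]]]]||||].
- apply: ideal_gen; exists (edge_aut s e1), (map (edge_aut s) s1).
  exists (edge_aut s e2), (map (edge_aut s) s2), i; split.
  + by rewrite hasse_path_aut.
  + by rewrite hasse_path_aut.
  + split; first by rewrite !edge_tail_aut eqt.
    by rewrite !last_map !edge_head_aut eqh.
  + by rewrite rmorphB /= !free_aut_coef_path_poly.
- by rewrite (rmorph0 free_aut); apply: ideal_zero.
- by move=> x y _ xI _ yI; rewrite (rmorphD free_aut); exact (ideal_add xI yI).
- by move=> a x _ xI; rewrite (rmorphM free_aut); exact (ideal_mull _ xI).
- by move=> a x _ xI; rewrite (rmorphM free_aut); exact (ideal_mulr _ xI).
Qed.

(* Independent of the representative: see splitting_aut_pi. *)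
Definition splitting_aut (x : A) : A := splitting_pi (free_aut (repr x)).

Lemma splitting_aut_pi g :
  splitting_aut (splitting_pi g) = splitting_pi (free_aut g).
Proof.
apply/splitting_piP; rewrite -rmorphB.
exact/free_aut_ideal/repr_splitting_pi.
Qed.

Lemma splitting_aut_zmod_morphism : zmod_morphism splitting_aut.
Proof.
move=> x y; case: (splitting_pi_surj x) => g ->.
case: (splitting_pi_surj y) => h ->.
by rewrite -rmorphB /= !splitting_aut_pi !rmorphB.
Qed.

Lemma splitting_aut_monoid_morphism : monoid_morphism splitting_aut.
Proof.
split; first by rewrite -[1](rmorph1 (@splitting_pi F d P)) splitting_aut_pi !rmorph1.
move=> x y; case: (splitting_pi_surj x) => g ->.
case: (splitting_pi_surj y) => h ->.
by rewrite -rmorphM /= !splitting_aut_pi !rmorphM.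
Qed.

Lemma splitting_aut_scalable : scalable splitting_aut.
Proof.
move=> k x; case: (splitting_pi_surj x) => g ->.
by rewrite -linearZ /= !splitting_aut_pi !linearZ.
Qed.

HB.instance Definition _ :=
  GRing.isZmodMorphism.Build A A splitting_aut splitting_aut_zmod_morphism.
HB.instance Definition _ :=
  GRing.isMonoidMorphism.Build A A splitting_aut splitting_aut_monoid_morphism.
HB.instance Definition _ :=
  GRing.isScalable.Build F A A *:%R splitting_aut splitting_aut_scalable.

Lemma splitting_aut_gen e :
  splitting_aut (splitting_gen F e) = splitting_gen F (edge_aut s e).
Proof. by rewrite /splitting_gen splitting_aut_pi free_aut_gen. Qed.

End InducedAut.

Section GradedTrace.
Variables (F : fieldType) (V : lmodType F).

Definition lin_comb m (b : 'I_m -> V) (a : 'rV[F]_m) : V :=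
  \sum_(j < m) a 0 j *: b j.

Definition basis_of_subspace (S : V -> Prop) m (b : 'I_m -> V) : Prop :=
  [/\ forall i, S (b i),
      forall a, lin_comb b a = 0 -> a = 0
    & forall x, S x -> exists a, x = lin_comb b a].

(* "S is finite-dimensional and the restriction of f to S has trace c": the *)
(* rows of M are the coordinates of the images of the basis vectors.        *)
Definition has_trace_on (S : V -> Prop) (f : V -> V) (c : F) : Prop :=
  exists m (b : 'I_m -> V) (M : 'M[F]_m),
    [/\ basis_of_subspace S b,
        forall i, f (b i) = lin_comb b (row i M)
      & \tr M = c].

Definition has_graded_trace (A : nat -> V -> Prop) (f : V -> V)
    (t : nat -> F) : Prop :=
  forall i, has_trace_on (A i) f (t i).

Lemma lin_comb_is_linear m (b : 'I_m -> V) : linear (lin_comb b).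
Proof.
move=> k u v; rewrite /lin_comb scaler_sumr -big_split /=.
by apply: eq_bigr => j _; rewrite !mxE scalerDl scalerA.
Qed.

HB.instance Definition _ m (b : 'I_m -> V) :=
  GRing.isLinear.Build F 'rV[F]_m V *:%R (lin_comb b) (lin_comb_is_linear b).

Lemma lin_comb_inj S m (b : 'I_m -> V) :
  basis_of_subspace S b -> injective (lin_comb b).
Proof.
case=> _ b_free _ u v uv; apply/eqP; rewrite -subr_eq0; apply/eqP.
by apply: b_free; rewrite linearB /= uv subrr.
Qed.

Lemma lin_comb_mul m p (b : 'I_m -> V) (c : 'I_p -> V) (M : 'M[F]_(m, p)) u :
  (forall i, b i = lin_comb c (row i M)) -> lin_comb b u = lin_comb c (u *m M).
Proof.
move=> bE; rewrite mulmx_sum_row linear_sum.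
by apply: eq_bigr => i _; rewrite linearZ /= bE.
Qed.

Lemma lin_comb_delta m (b : 'I_m -> V) i : lin_comb b (delta_mx 0 i) = b i.
Proof.
rewrite /lin_comb (bigD1 i) //= mxE !eqxx scale1r big1 ?addr0 // => j ji.
by rewrite mxE eqxx (negPf ji) scale0r.
Qed.

Lemma change_of_basis S m p (b : 'I_m -> V) (c : 'I_p -> V) :
  basis_of_subspace S b -> basis_of_subspace S c ->
  exists M : 'M[F]_(m, p), forall i, b i = lin_comb c (row i M).
Proof.
move=> [bS _ _] [_ _ c_span].
have /fin_all_exists [a aE] i := c_span _ (bS i).
by exists (\matrix_i a i) => i; rewrite rowK.
Qed.

Lemma has_trace_on_unique S (f : {linear V -> V}) c1 c2 :
  has_trace_on S f c1 -> has_trace_on S f c2 -> c1 = c2.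
Proof.
move=> [m [b [M [bB fb <-]]]] [p [c [N [cB fc <-]]]].
have [Q bE] := change_of_basis bB cB; have [R cE] := change_of_basis cB bB.
have QR : Q *m R = 1%:M.
  apply/row_matrixP => i; apply: (lin_comb_inj bB).
  by rewrite row_mul -(lin_comb_mul _ cE) -bE row1 lin_comb_delta.
have MQ : M *m Q = Q *m N.
  apply/row_matrixP => i; apply: (lin_comb_inj cB).
  rewrite !row_mul -(lin_comb_mul _ bE) -fb bE -(lin_comb_mul _ fc).
  rewrite [lin_comb c _ in LHS]/lin_comb linear_sum.
  by apply: eq_bigr => j _; rewrite linearZ.
have RQ : R *m Q = 1%:M.
  apply/row_matrixP => i; apply: (lin_comb_inj cB).
  by rewrite row_mul -(lin_comb_mul _ bE) -cE row1 lin_comb_delta.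
by rewrite -[M]mulmx1 -QR mulmxA MQ mxtrace_mulC mulmxA RQ mul1mx.
Qed.

End GradedTrace.

Section PowerSeriesQuotient.
Variables (F : fieldType) (N D : {poly F}).

(* The first k coefficients of the power series N / D, assuming D`_0 != 0. *)
Fixpoint series_div_prefix (k : nat) : seq F :=
  if k is k'.+1 then
    let q := series_div_prefix k' in
    rcons q ((N`_k' - \sum_(i < k') q`_i * D`_(k' - i)) / D`_0)
  else [::].

(* series_divP characterizes the quotient by q * D = N. *)
Definition series_div (k : nat) : F := (series_div_prefix k.+1)`_k.

Lemma size_series_div_prefix k : size (series_div_prefix k) = k.
Proof. by elim: k => //= k IHk; rewrite size_rcons IHk. Qed.

Lemma nth_series_div_prefix k i :
  (i < k)%N -> (series_div_prefix k)`_i = series_div i.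
Proof.
elim: k => // k IHk; rewrite ltnS leq_eqVlt => /orP[/eqP -> //|ik].
by rewrite /= nth_rcons size_series_div_prefix ik IHk.
Qed.

Lemma series_divP : D`_0 != 0 ->
  forall k, \sum_(i < k.+1) series_div i * D`_(k - i) = N`_k.
Proof.
move=> D0 k; rewrite big_ord_recr /= subnn {2}/series_div /=.
rewrite nth_rcons size_series_div_prefix ltnn eqxx divfK //.
rewrite [X in _ - X](eq_bigr (fun i : 'I_k => series_div i * D`_(k - i))).
  by rewrite addrC subrK.
by move=> i _; rewrite nth_series_div_prefix.
Qed.

End PowerSeriesQuotient.

Section Factors.
Local Open Scope nat_scope.

Definition Omega (m : nat) : nat := \sum_(p <- primes m) logn p m.

(* The alias natdvd equips the subtype with the divisibility order. *)
Definition factor (n : nat) := seq_sub (divisors n : seq natdvd).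

HB.instance Definition _ n := SubFinite.on (factor n).
HB.instance Definition _ n :=
  [SubChoice_isSubPOrder of factor n by <: with Order.dvd_display].

Definition factor_val n (m : factor n) : nat := ssval m.

Definition prime_factor (n : nat) := seq_sub (primes n).

HB.instance Definition _ n := SubFinite.on (prime_factor n).

Lemma factor_leE n (m k : factor n) :
  (m <= k)%O = (factor_val m %| factor_val k).
Proof. by []. Qed.

Lemma factor_val_inj n : injective (@factor_val n).
Proof. exact: val_inj. Qed.

Lemma mem_divisors n m : (m \in divisors n) = (m %| n) && ((n == 0) ==> (m == 1)).
Proof.
case: n => [|n]; first by rewrite dvdn0 inE.
by rewrite -dvdn_divisors ?andbT.
Qed.

Lemma factor_dvd n (m : factor n) : factor_val m %| n.
Proof. by have := ssvalP m; rewrite mem_divisors => /andP[]. Qed.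

Lemma factor_gt0 n (m : factor n) : 0 < factor_val m.
Proof.
rewrite /factor_val; have := ssvalP m; rewrite mem_divisors => /andP[].
by case: n m => [|n] m mn; [move=> /eqP -> | move=> _; apply: dvdn_gt0 mn].
Qed.

Lemma factor_down n (m : factor n) k :
  k %| factor_val m -> k \in divisors n.
Proof.
rewrite /factor_val; have := ssvalP m; rewrite !mem_divisors.
move: (ssval m) => v /andP[vn v1] kv; rewrite (dvdn_trans kv vn) /=.
by apply/implyP => n0; rewrite n0 /= in v1; move: kv; rewrite (eqP v1) dvdn1.
Qed.

Lemma Omega_widen N m : m < N -> Omega m = \sum_(0 <= p < N) logn p m.
Proof.
move=> mN; rewrite (bigID (mem (primes m))) /= addnC big1 ?add0n; last first.
  by move=> p; rewrite lognE mem_primes; case: ifP => // ->.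
rewrite -big_filter; apply: perm_big; apply: uniq_perm.
- exact: primes_uniq.
- by rewrite filter_uniq // iota_uniq.
move=> p; rewrite mem_filter mem_index_iota /=.
case: (boolP (p \in primes m)) => //=; rewrite mem_primes => /and3P[_ m0 pm].
by rewrite (leq_ltn_trans (dvdn_leq m0 pm) mN).
Qed.

Lemma Omega_mul_prime m p : 0 < m -> prime p -> Omega (m * p) = (Omega m).+1.
Proof.
move=> m0 pp; have p0 := prime_gt0 pp.
rewrite (@Omega_widen (m * p).+1) // (@Omega_widen (m * p).+1 m); last first.
  by rewrite ltnS leq_pmulr.
rewrite (eq_bigr (fun q => logn q m + (q == p))); last first.
  by move=> q _; rewrite lognM // (logn_prime _ pp).
rewrite big_split /= -[RHS]addn1; congr (_ + _).
rewrite (bigD1_seq p) ?iota_uniq //=; last first.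
  by rewrite mem_index_iota /= ltnS leq_pmull.
by rewrite eqxx big1 ?addn0 // => q /negPf ->.
Qed.

Lemma Omega_eq0 m : 0 < m -> Omega m = 0 -> m = 1.
Proof.
move=> m0; case: (ltngtP m 1) => // [|m1 Om]; first by rewrite ltnNge m0.
have [p pp pm] : exists2 p, prime p & p %| m.
  by exists (pdiv m); [apply: pdiv_prime | apply: pdiv_dvd].
have m'0 : 0 < m %/ p by rewrite divn_gt0 ?prime_gt0 // dvdn_leq.
by move: Om; rewrite -(divnK pm) Omega_mul_prime.
Qed.

Lemma factor_rank_minimal n (m : factor n) :
  Omega (factor_val m) = 0 <-> (forall k : factor n, (k <= m)%O -> k = m).
Proof.
split=> [/(Omega_eq0 (factor_gt0 m)) m1 k|mmin].
  by rewrite factor_leE m1 dvdn1 => /eqP k1; apply: factor_val_inj; rewrite k1.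
have m1 := mmin (SeqSub (divisor1 n : (1 : natdvd) \in (divisors n : seq natdvd))).
by rewrite -m1 ?factor_leE ?dvd1n // /Omega big_nil.
Qed.

Lemma factor_rank_covers n (q p : factor n) :
  covers q p -> Omega (factor_val q) = (Omega (factor_val p)).+1.
Proof.
rewrite /covers lt_neqAle factor_leE.
move=> /andP[/andP[pq /dvdnP[k qE]] /forallP qmin].
have p0 := factor_gt0 p; have q0 := factor_gt0 q.
have k1 : 1 < k.
  case: k qE => [|[|//]] qE; first by move: q0; rewrite qE.
  by case/eqP: pq; apply: factor_val_inj; rewrite qE mul1n.
pose r := pdiv k; have rp : prime r := pdiv_prime k1.
have rdvd : factor_val p * r %| factor_val q.
  by rewrite qE mulnC dvdn_pmul2r // pdiv_dvd.
pose x : factor n := SeqSub (factor_down rdvd : (_ : natdvd) \in (divisors n : seq natdvd)).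
have := qmin x; rewrite !factor_leE rdvd dvdn_mulr //=.
case/orP => /eqP/(congr1 (@factor_val n)) /= xE.
  by have := prime_gt1 rp; rewrite -(ltn_pmul2l p0) muln1 [X in _ < X]xE ltnn.
by rewrite -xE Omega_mul_prime.
Qed.

HB.instance Definition _ n :=
  FinPOrder_isRanked.Build Order.dvd_display (factor n)
    (@factor_rank_minimal n) (@factor_rank_covers n).

End Factors.

Section FactorAut.
Local Open Scope nat_scope.
Variable n : nat.
Implicit Types (s : {perm prime_factor n}) (m k : factor n).

Definition preserves_multiplicity s : Prop :=
  forall p : prime_factor n, logn (val (s p)) n = logn (val p) n.

Definition factor_act s m : nat :=
  \prod_(p : prime_factor n) val (s p) ^ logn (val p) (factor_val m).

Lemma prime_factor_prime (p : prime_factor n) : prime (val p).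
Proof. by have := ssvalP p; rewrite mem_primes => /andP[]. Qed.

Lemma factor_act_gt0 s m : 0 < factor_act s m.
Proof.
rewrite prodn_gt0 // => p; rewrite expn_gt0 prime_gt0 //.
exact: prime_factor_prime.
Qed.

Lemma logn_factor_act s m q : prime q -> logn q (factor_act s m) =
  \sum_(p : prime_factor n) (q == val (s p)) * logn (val p) (factor_val m).
Proof.
move=> qp; rewrite /factor_act.
suff [_ ->] : 0 < \prod_(p : prime_factor n) val (s p) ^ logn (val p) (factor_val m) /\
  logn q (\prod_(p : prime_factor n) val (s p) ^ logn (val p) (factor_val m)) =
  \sum_(p : prime_factor n) (q == val (s p)) * logn (val p) (factor_val m) by [].
apply: (big_ind2 (fun x y => 0 < x /\ logn q x = y)).
- by rewrite logn1.
- by move=> x1 y1 x2 y2 [x10 <-] [x20 <-]; rewrite muln_gt0 x10 x20 lognM.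
move=> p _; rewrite expn_gt0 prime_gt0 ?prime_factor_prime //; split=> //.
by rewrite lognX [logn q _]logn_prime ?prime_factor_prime // mulnC.
Qed.

Lemma logn_factor_act_in s m (q : prime_factor n) :
  logn (val (s q)) (factor_act s m) = logn (val q) (factor_val m).
Proof.
rewrite logn_factor_act ?prime_factor_prime // (bigD1 q) //= eqxx mul1n.
rewrite big1 ?addn0 // => p pq.
suff /negPf -> : val (s q) != val (s p) by [].
by apply: contra pq => /eqP/val_inj/perm_inj ->.
Qed.

Lemma logn_factor_act_out s m q :
  q \notin primes n -> logn q (factor_act s m) = 0.
Proof.
move=> qn; case: (boolP (prime q)) => [qp|/negPf qp]; last first.
  by rewrite lognE qp.
rewrite logn_factor_act // big1 // => p _; case: eqP => // qE.
by move: qn; rewrite qE; case: (s p) => r /= ->.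
Qed.

Lemma dvdn_logn a b : 0 < a -> 0 < b ->
  (forall p, prime p -> logn p a <= logn p b) -> a %| b.
Proof.
move=> a0 b0 ab; suff <- : gcdn a b = a by exact: dvdn_gcdr.
apply: eqn_from_log => // [|p]; first by rewrite gcdn_gt0 a0.
case: (boolP (prime p)) => [pp|/negPf pp]; last by rewrite lognE pp [RHS]lognE pp.
by rewrite logn_gcd //; apply/minn_idPl/ab.
Qed.

Lemma logn_factor_out m q : q \notin primes n -> logn q (factor_val m) = 0.
Proof.
move=> qn; rewrite lognE; case: ifP => // /and3P[qp _ qm].
move: qn qm; rewrite mem_primes qp /= /factor_val.
have := ssvalP m; rewrite mem_divisors; move: (ssval m) => v /andP[vn v1].
have [n0|n0] := posnP n.
  rewrite n0 eqxx /= in v1; rewrite (eqP v1) dvdn1 => _ /eqP q1.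
  by rewrite q1 in qp.
by rewrite /= => qn qv; rewrite (dvdn_trans qv vn) in qn.
Qed.

Lemma factor_act_dvd s m k : (factor_act s m %| factor_act s k) = (factor_val m %| factor_val k).
Proof.
apply/idP/idP => mk; apply: dvdn_logn; rewrite ?factor_gt0 ?factor_act_gt0 //.
  move=> q qp; case: (boolP (q \in primes n)) => [qn|/logn_factor_out -> //].
  rewrite -!(logn_factor_act_in s _ (SeqSub qn)).
  exact: dvdn_leq_log (factor_act_gt0 _ _) mk.
move=> q qp; case: (boolP (q \in primes n)) => [qn|]; last first.
  by move/logn_factor_act_out => ->.
have -> : q = val (s (s^-1%g (SeqSub qn))) by rewrite permKV.
rewrite !logn_factor_act_in; exact: dvdn_leq_log (factor_gt0 _) mk.
Qed.

Lemma factor_act_mem s m :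
  preserves_multiplicity s -> factor_act s m \in divisors n.
Proof.
move=> Hs; rewrite mem_divisors.
have [n0|n0] := posnP n; last first.
  rewrite andbT; apply: dvdn_logn; rewrite ?factor_act_gt0 // => q qp.
  case: (boolP (q \in primes n)) => [qn|/logn_factor_act_out -> //].
  have -> : q = val (s (s^-1%g (SeqSub qn))) by rewrite permKV.
  rewrite logn_factor_act_in Hs; exact: dvdn_leq_log n0 (factor_dvd m).
rewrite [in X in _ %| X]n0 dvdn0 /= /factor_act big1 // => p _.
by have := ssvalP p; rewrite [in X in _ \in X]n0.
Qed.

Definition factor_map s (Hs : preserves_multiplicity s) m : factor n :=
  SeqSub (factor_act_mem m Hs : (_ : natdvd) \in (divisors n : seq natdvd)).

Lemma factor_mapE s (Hs : preserves_multiplicity s) m :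
  factor_val (factor_map Hs m) = factor_act s m.
Proof. by []. Qed.

Lemma factor_map_mono s (Hs : preserves_multiplicity s) :
  {mono factor_map Hs : m k / (m <= k)%O}.
Proof.
move=> m k; rewrite (factor_leE m k) (factor_leE (factor_map _ _)).
rewrite (factor_mapE Hs m) (factor_mapE Hs k). exact (factor_act_dvd s m k).
Qed.

Lemma factor_map_inj s (Hs : preserves_multiplicity s) :
  injective (factor_map Hs).
Proof.
move=> m k mk; apply/eqP; rewrite eq_le.
by rewrite -(factor_map_mono Hs m k) -(factor_map_mono Hs k m) mk lexx.
Qed.

Lemma factor_perm_mono s (Hs : preserves_multiplicity s) :
  {mono perm (@factor_map_inj s Hs) : m k / (m <= k)%O}.
Proof. by move=> m k; rewrite !permE; exact: (factor_map_mono Hs m k). Qed.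

Definition factor_aut s (Hs : preserves_multiplicity s) : poset_aut (factor n) :=
  PosetAut (factor_perm_mono Hs).

Lemma factor_autE s (Hs : preserves_multiplicity s) m :
  factor_val (factor_aut Hs m) = factor_act s m.
Proof. by rewrite /= permE. Qed.

End FactorAut.

(* Main.v *)
Require Import Defs.
From HB Require Import structures.
From mathcomp Require Import all_boot all_order all_fingroup all_algebra.
From mathcomp Require Import finmap zify ring boolp.
From mathcomp.multinomials Require Import monalg.

Set Implicit Arguments.
Unset Strict Implicit.
Unset Printing Implicit Defensive.

Import Order.TTheory GRing.Theory.
Local Open Scope ring_scope.

(** The idea is to find a basis of the splitting algebra of a ranked poset with
    a bottom, formed by words that the automorphism permutes, and then to count
    the words that it fixes.

    Basis.  To a path one attaches the product of the factors [1 - e X] over its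
    edges [e].  In the splitting algebra this product depends on the ends of the
    path only; for paths from [v] to the bottom, let [(v, k)] be its coefficient
    of degree [k], where [0 < k <= rank v].  An edge from [v] to [w] equals
    [(w, 1) - (v, 1)], so that these letters generate the algebra, and all
    relations between them say that for [w <= v] the polynomial of [v] is a
    multiple of that of [w] on the left, with a quotient of degree
    [rank v - rank w].  The remainders of the division are relations whose
    leading words are the [(v, k) (w, l)] with [w < v] and
    [k = rank v - rank w], and which contain [(v, k + l)]; all other words in
    them are lighter for a suitable weight.  Call a word normal if it has no
    factor of that form.  By the diamond lemma ([nf_ideal0]) the normal words
    form a basis as soon as overlaps [(v, k) (w, l) (x, m)] are resolved by
    relations of smaller weight.  This follows ([rempoly_overlap]) from comparing
    two divisions of the polynomial of [v], directly by that of [x], or first by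
    that of [w]: the coefficients of this comparison are the required identities.

    Trace.  An automorphism maps a path from [v] to a path from the image of [v],
    hence [(v, k)] to the letter of the image with the same [k].  It permutes the
    normal words, and its trace in degree [i] is the number of normal words of
    degree [i] in letters at fixed vertices ([trace_words]).

    Counting.  Let [C] be the generating series of these words and [U v] that of
    the words starting at [v].  A word starting at [v] is a letter [(v, k)] and
    then any word but those starting at some [w < v] with
    [k = rank v - rank w]; so the sum of [X^(rank v - rank w) U w] over the fixed
    [w <= v] is [C] times [X + ... + X^(rank v)] ([total_at_rec]).  Moebius
    inversion on the fixed subposet yields [C (1 - X M) = 1 - X], with [M] the
    sum of [mu (w, v) X^(rank v - rank w)] over the fixed pairs [w <= v]
    ([total_eq]).

    Factors of [n].  The fixed factors are those whose exponents are constant on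
    the cycles of the permutation, so that the fixed subposet is a product of
    chains, one for each cycle [c], with [m c] steps of rank [#|c|].  On such a
    chain the sum is [1 + m c (1 - X^#|c|)], and [M] is the product of these
    ([sum_orbit_weight]). *)

(** * Free algebras: words, supports, universal property *)

(** A free associative algebra on [L], through its basis of words.  It is used
    twice: on the edges of the Hasse diagram, and on vertex coefficients. *)
Record freeAlg (F : fieldType) (L : choiceType) := FreeAlg {
  freeAlg_sort :> algType F;
  wd : seq L -> freeAlg_sort;
  coefw : seq L -> freeAlg_sort -> F;
  suppw : freeAlg_sort -> seq (seq L);
  coefw_is_linear : forall u, linear_for *%R (coefw u);
  coefw_wd : forall u v, coefw u (wd v) = (u == v)%:R;
  wdM : forall u v, wd u * wd v = wd (u ++ v);
  wd_nil : wd [::] = 1;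
  suppw_uniq : forall g, uniq (suppw g);
  suppwE : forall g, g = \sum_(u <- suppw g) coefw u g *: wd u
}.
Arguments wd {F L} f u : rename.
Arguments coefw {F L f} u g : rename.
Arguments suppw {F L f} g : rename.

Section FreeAlgTheory.
Variables (F : fieldType) (L : choiceType) (T : freeAlg F L).
Implicit Types (g h : T) (u v w : seq L).
Local Notation wd := (wd T).

HB.instance Definition _ u :=
  GRing.isLinear.Build F T F *%R (coefw u) (@coefw_is_linear F L T u).

Lemma coefw_sum (I : Type) (r : seq I) (c : I -> F) (f : I -> seq L) u :
  coefw u (\sum_(i <- r) c i *: wd (f i)) = \sum_(i <- r | f i == u) c i.
Proof.
rewrite linear_sum [RHS]big_mkcond; apply: eq_bigr => i _.
by rewrite linearZ /= coefw_wd eq_sym; case: eqP => _; rewrite ?mulr1 ?mulr0.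
Qed.

Lemma mem_suppw u g : coefw u g != 0 -> u \in suppw g.
Proof.
apply: contraR => ug; rewrite {1}(suppwE g) coefw_sum big_seq_cond big1 // => v.
by case/andP=> vg /eqP vu; rewrite vu (negPf ug) in vg.
Qed.

Lemma coefwP g h : (forall u, coefw u g = coefw u h) -> g = h.
Proof.
move=> gh; apply/eqP; rewrite -subr_eq0 (suppwE (g - h)); apply/eqP.
by apply: big1 => u _; rewrite linearB /= gh subrr scale0r.
Qed.

Lemma freeAlg_ind (Q : T -> Prop) :
  Q 0 -> (forall a g h, Q g -> Q h -> Q (a *: g + h)) -> (forall u, Q (wd u)) ->
  forall g, Q g.
Proof.
move=> Q0 QD Qw g; rewrite (suppwE g).
elim: (suppw g) => [|k s IHs]; first by rewrite big_nil.
by rewrite big_cons; apply: QD.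
Qed.

(** Homogeneity, normality and bounds on weights are all of this form. *)
Definition supp_in (S : seq L -> Prop) g := forall u, coefw u g != 0 -> S u.

Lemma supp_in_ind (S : seq L -> Prop) (Q : T -> Prop) :
  Q 0 -> (forall a g h, Q g -> Q h -> Q (a *: g + h)) ->
  (forall u, S u -> Q (wd u)) -> forall g, supp_in S g -> Q g.
Proof.
move=> Q0 QD Qw g Sg; rewrite (suppwE g).
elim: (suppw g) => [|u s IHs]; first by rewrite big_nil.
rewrite big_cons; have [->|/Sg Su] := eqVneq (coefw u g) 0.
  by rewrite scale0r add0r.
by apply: QD => //; apply: Qw.
Qed.

Lemma supp_in0 S : supp_in S 0.
Proof. by move=> u; rewrite raddf0 eqxx. Qed.

Lemma supp_inD S g h : supp_in S g -> supp_in S h -> supp_in S (g + h).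
Proof.
move=> Sg Sh u; rewrite raddfD /=.
have [->|/Sg //] := eqVneq (coefw u g) 0; rewrite add0r; exact: Sh.
Qed.

Lemma supp_inZ S a g : supp_in S g -> supp_in S (a *: g).
Proof.
move=> Sg u; rewrite linearZ /=.
by have [->|/Sg //] := eqVneq (coefw u g) 0; rewrite mulr0 eqxx.
Qed.

Lemma supp_inN S g : supp_in S g -> supp_in S (- g).
Proof. by move=> Sg; rewrite -scaleN1r; apply: supp_inZ. Qed.

Lemma supp_inB S g h : supp_in S g -> supp_in S h -> supp_in S (g - h).
Proof. by move=> Sg Sh; apply: supp_inD => //; apply: supp_inN. Qed.

Lemma supp_in_sum S (I : Type) (r : seq I) (P : pred I) (f : I -> T) :
  (forall i, P i -> supp_in S (f i)) -> supp_in S (\sum_(i <- r | P i) f i).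
Proof.
move=> Sf; apply: big_ind => //; [exact: supp_in0|move=> ? ?; exact: supp_inD].
Qed.

Lemma supp_in_wd (S : seq L -> Prop) u : S u -> supp_in S (wd u).
Proof. by move=> Su v; rewrite coefw_wd; have [->|] := eqVneq v u; rewrite ?eqxx. Qed.

Lemma supp_inS (S S' : seq L -> Prop) g :
  (forall u, S u -> S' u) -> supp_in S g -> supp_in S' g.
Proof. by move=> SS Sg u /Sg /SS. Qed.

Lemma supp_inM (S1 S2 S3 : seq L -> Prop) g h :
  (forall u v, S1 u -> S2 v -> S3 (u ++ v)) ->
  supp_in S1 g -> supp_in S2 h -> supp_in S3 (g * h).
Proof.
move=> S12 Sg Sh; move: g Sg; apply: supp_in_ind => [|a g g' IHg IHg'|u Su].
- by rewrite mul0r; apply: supp_in0.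
- by rewrite mulrDl -scalerAl; apply: supp_inD => //; apply: supp_inZ.
move: h Sh; apply: supp_in_ind => [|a h h' IHh IHh'|v Sv].
- by rewrite mulr0; apply: supp_in0.
- by rewrite mulrDr -scalerAr; apply: supp_inD => //; apply: supp_inZ.
by rewrite wdM; apply: supp_in_wd; apply: S12.
Qed.

Section LinearExtension.
Variables (V : lmodType F) (f : seq L -> V).

Definition lext g : V := \sum_(u <- suppw g) coefw u g *: f u.

Lemma lextEw (r : seq (seq L)) g : uniq r -> {subset suppw g <= r} ->
  lext g = \sum_(u <- r) coefw u g *: f u.
Proof.
move=> r_uniq sub; rewrite [RHS](bigID (mem (suppw g))) /= [X in _ + X]big1.
  rewrite addr0 -big_filter; apply: perm_big; apply: uniq_perm.
  - exact: suppw_uniq.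
  - exact: filter_uniq.
  by move=> u; rewrite mem_filter; case: (boolP (u \in _)) => // /sub ->.
move=> u ug; have [->|/mem_suppw] := eqVneq (coefw u g) 0.
  by rewrite scale0r.
by rewrite (negPf ug).
Qed.

Lemma lext_is_linear : linear lext.
Proof.
move=> a g h.
pose r := undup (suppw g ++ suppw h ++ suppw (a *: g + h)).
have r_uniq : uniq r by apply: undup_uniq.
rewrite !(@lextEw r) //; try by [move=> u; rewrite /r mem_undup !mem_cat => ->; rewrite ?orbT].
rewrite scaler_sumr -big_split /=; apply: eq_bigr => u _.
by rewrite scalerA -scalerDl linearP.
Qed.

HB.instance Definition _ :=
  GRing.isLinear.Build F T V *:%R lext lext_is_linear.

Lemma lext_wd u : lext (wd u) = f u.
Proof.
rewrite (@lextEw (undup (u :: suppw (wd u)))) ?undup_uniq //; last first.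
  by move=> v vr; rewrite mem_undup inE vr orbT.
rewrite (bigD1_seq u) ?mem_undup ?mem_head ?undup_uniq // [LHS]/=.
rewrite coefw_wd eqxx scale1r [X in _ + X]big1 ?addr0 // => v vu.
by rewrite coefw_wd (negPf vu) scale0r.
Qed.

End LinearExtension.

Section AlgebraExtension.
Variables (B : algType F) (phi : L -> B).

Definition aext : T -> B := lext (fun u => \prod_(x <- u) phi x).

HB.instance Definition _ := GRing.Linear.on aext.

Lemma aext_wd u : aext (wd u) = \prod_(x <- u) phi x.
Proof. exact: lext_wd. Qed.

Lemma aext_is_monoid_morphism : monoid_morphism aext.
Proof.
split; first by rewrite -wd_nil aext_wd big_nil.
move=> g h; elim/freeAlg_ind: g => [|a g g' IHg IHg'|u].
- by rewrite mul0r linear0 mul0r.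
- by rewrite mulrDl -scalerAl !linearP /= IHg IHg' mulrDl scalerAl.
elim/freeAlg_ind: h => [|a h h' IHh IHh'|v].
- by rewrite mulr0 linear0 mulr0.
- by rewrite mulrDr -scalerAr !linearP /= IHh IHh' mulrDr scalerAr.
by rewrite wdM !aext_wd big_cat.
Qed.

HB.instance Definition _ :=
  GRing.isMonoidMorphism.Build T B aext aext_is_monoid_morphism.

End AlgebraExtension.

End FreeAlgTheory.

Lemma ideal_morph_ext (F : fieldType) (L : choiceType) (T : freeAlg F L)
    (B : algType F)
    (G : B -> Prop) (f1 f2 : {lrmorphism T -> B}) :
  (forall x, two_sided_ideal G (f1 (wd T [:: x]) - f2 (wd T [:: x]))) ->
  forall g, two_sided_ideal G (f1 g - f2 g).
Proof.
move=> fx; elim/freeAlg_ind => [|a g h IHg IHh|u].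
- by rewrite !rmorph0 subr0; apply: ideal_zero.
- rewrite (linearP f1) (linearP f2) opprD addrACA -scalerBr; apply: ideal_add => //.
  by rewrite -[_ - _]mul1r scalerAl; apply: ideal_mull.
elim: u => [|x u IHu]; first by rewrite wd_nil !rmorph1 subrr; apply: ideal_zero.
rewrite -cat1s -wdM !rmorphM.
have -> (a b c d : B) : a * b - c * d = (a - c) * b + c * (b - d).
  by rewrite mulrBl mulrBr addrA subrK.
apply: ideal_add; first by apply: ideal_mulr; exact: fx.
by apply: ideal_mull; exact: IHu.
Qed.

(** The monoid algebra of the free monoid is a free algebra. *)
Section MalgFree.
Variables (F : fieldType) (L : choiceType).

Definition word_alg := {malg F[{fmonom L}]}.
HB.instance Definition _ := GRing.Lalgebra.on word_alg.

Lemma word_scalerAr (k : F) (x y : word_alg) : k *: (x * y) = x * (k *: y).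
Proof.
suff H (z : word_alg) : z * malgC k = k *: z by rewrite -H -mulrA H.
rewrite malgM_def fgmulgU malgZ_def /fgscale.
by apply: eq_bigr => w _; rewrite mulm1 mulrC.
Qed.

HB.instance Definition _ :=
  GRing.Lalgebra_isAlgebra.Build F word_alg word_scalerAr.

Let wd u : word_alg := << FMonom u >>.
Let coefw u (g : word_alg) : F := g@_(FMonom u).
Let suppw (g : word_alg) : seq (seq L) := [seq val w | w <- enum_fset (msupp g)].

Lemma malg_coef_linear u : linear_for *%R (coefw u).
Proof. by move=> a g h; rewrite /coefw mcoeffD mcoeffZ. Qed.

Lemma malg_coef_word u v : coefw u (wd v) = (u == v)%:R.
Proof. by rewrite /coefw /wd mcoeffU1 eq_sym. Qed.

Lemma malg_wordM u v : wd u * wd v = wd (u ++ v).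
Proof.
rewrite /wd malgM_def fgmulUU mulr1; congr << 1 *g _ >>.
by apply: val_inj; rewrite /= fmM.
Qed.

Lemma malg_word_nil : wd [::] = 1.
Proof.
by rewrite /wd; congr << 1 *g _ >>; apply: val_inj; rewrite /= fm1.
Qed.

Lemma malg_supp_uniq g : uniq (suppw g).
Proof. by rewrite map_inj_uniq ?fset_uniq //; apply: val_inj. Qed.

Lemma malg_suppE g : g = \sum_(u <- suppw g) coefw u g *: wd u.
Proof.
rewrite big_map [LHS]monalgE; apply: eq_bigr => k _; apply/malgP => w.
by rewrite mcoeffZ /wd !mcoeffU mulr_natr; case: k.
Qed.

Definition malg_freeAlg : freeAlg F L :=
  FreeAlg malg_coef_linear malg_coef_word malg_wordM malg_word_nil
    malg_supp_uniq malg_suppE.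

End MalgFree.

(** * A diamond lemma for quadratic leading words *)

Lemma cat_split (X : Type) (u v u' v' : seq X) : u ++ v = u' ++ v' ->
  (exists c, u' = u ++ c /\ v = c ++ v') \/
  (exists x c, u = u' ++ x :: c /\ v' = x :: c ++ v).
Proof.
elim: u u' => [|x u IHu] [|x' u'] /=.
- by move=> ->; left; exists [::].
- by move=> ->; left; exists (x' :: u').
- by move=> <-; right; exists x, u.
case=> -> /IHu [[c [-> ->]]|[y [c [-> ->]]]]; first by left; exists c.
by right; exists y, c.
Qed.

Section Diamond.
Variables (F : fieldType) (L : choiceType) (T : freeAlg F L).
Variables (red : rel L) (tail : L -> L -> T) (wt : L -> nat).
Local Notation wd := (wd T).
Implicit Types (g h : T) (u v w : seq L) (x y z : L).

Definition weight u : nat := sumn (map wt u).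

Lemma weight_cat u v : weight (u ++ v) = (weight u + weight v)%N.
Proof. by rewrite /weight map_cat sumn_cat. Qed.

Definition relator x y : T := wd [:: x; y] - tail x y.

Definition relators g : Prop := exists x y, red x y /\ g = relator x y.

(** Filtering the ideal of the relators by the weight of leading words: the
    proof that normal forms vanish on the ideal is an induction on [b]. *)
Inductive low (b : nat) : T -> Prop :=
| low_relator u x y v : red x y -> (weight (u ++ x :: y :: v) < b)%N ->
    low b (wd u * relator x y * wd v)
| low0 : low b 0
| low_lin a g h : low b g -> low b h -> low b (a *: g + h).

Lemma lowD b g h : low b g -> low b h -> low b (g + h).
Proof. by rewrite -{2}[g]scale1r; apply: low_lin. Qed.

Lemma lowZ b a g : low b g -> low b (a *: g).
Proof. by move=> gb; rewrite -[_ *: _]addr0; apply: low_lin => //; exact: low0. Qed.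

Lemma lowN b g : low b g -> low b (- g).
Proof. by rewrite -scaleN1r; apply: lowZ. Qed.

Lemma lowB b g h : low b g -> low b h -> low b (g - h).
Proof. by move=> gb hb; apply: lowD => //; apply: lowN. Qed.

Lemma low_sum b (I : Type) (r : seq I) (P : pred I) (f : I -> T) :
  (forall i, P i -> low b (f i)) -> low b (\sum_(i <- r | P i) f i).
Proof.
by move=> fb; apply: big_ind => //; [exact: low0|move=> ? ?; exact: lowD].
Qed.

Lemma lowW b c g : (b <= c)%N -> low b g -> low c g.
Proof.
move=> bc; elim=> [u x y v xy ub||a g' h _ g'c _ hc]; last exact: low_lin.
  by apply: low_relator => //; apply: leq_trans bc.
exact: low0.
Qed.

Definition bounded (b : nat) : T -> Prop := supp_in (fun u => weight u <= b)%N.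

Lemma low_mull b c g h : bounded c h -> low b g -> low (b + c)%N (h * g).
Proof.
move=> hc gb; move: h hc; apply: supp_in_ind => [|a h h' IHh IHh'|w wc].
- by rewrite mul0r; apply: low0.
- by rewrite mulrDl -scalerAl; apply: low_lin.
elim: gb => [u x y v xy ub||a g' h _ g'c _ hc].
- rewrite !mulrA wdM; apply: low_relator => //.
  by rewrite -catA weight_cat; lia.
- by rewrite mulr0; apply: low0.
by rewrite mulrDr -scalerAr; apply: low_lin.
Qed.

Lemma low_mulr b c g h : bounded c h -> low b g -> low (b + c)%N (g * h).
Proof.
move=> hc gb; move: h hc; apply: supp_in_ind => [|a h h' IHh IHh'|w wc].
- by rewrite mulr0; apply: low0.
- by rewrite mulrDr -scalerAr; apply: low_lin.
elim: gb => [u x y v xy ub||a g' h _ g'c _ hc].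
- rewrite -[in X in low _ X]mulrA wdM; apply: low_relator => //.
  by rewrite -!cat_cons catA weight_cat; lia.
- by rewrite mul0r; apply: low0.
by rewrite mulrDl -scalerAl; apply: low_lin.
Qed.

Lemma low_mull_lt b c g h :
  supp_in (fun u => weight u < c)%N h -> low b.+1 g -> low (b + c)%N (h * g).
Proof.
move=> hc gb; move: h hc; apply: supp_in_ind => [|a h h' IHh IHh'|w wc].
- by rewrite mul0r; apply: low0.
- by rewrite mulrDl -scalerAl; apply: low_lin.
apply: (@lowW (b.+1 + weight w)); first lia.
by apply: low_mull => //; apply: supp_in_wd.
Qed.

Lemma low_mulr_lt b c g h :
  supp_in (fun u => weight u < c)%N h -> low b.+1 g -> low (b + c)%N (g * h).
Proof.
move=> hc gb; move: h hc; apply: supp_in_ind => [|a h h' IHh IHh'|w wc].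
- by rewrite mulr0; apply: low0.
- by rewrite mulrDr -scalerAr; apply: low_lin.
apply: (@lowW (b.+1 + weight w)); first lia.
by apply: low_mulr => //; apply: supp_in_wd.
Qed.

Lemma low_ideal b g : low b g -> two_sided_ideal relators g.
Proof.
elim=> [u x y v xy _||a g' h _ g'I _ hI]; last 1 first.
- by apply: ideal_add => //; rewrite -[g']mul1r scalerAl; apply: ideal_mull.
- by apply/ideal_mulr/ideal_mull/ideal_gen; exists x, y.
- exact: ideal_zero.
Qed.

Definition normal_word u : bool := sorted (fun x y => ~~ red x y) u.

Lemma normal_pair u x y v : red x y -> normal_word (u ++ x :: y :: v) = false.
Proof.
by case: u => [|z u] xy; rewrite /normal_word /= ?cat_path /= xy ?andbF.
Qed.

(** Reducing at the leftmost pair [x0 y0] leaves two positions for any other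
    reducible pair: it overlaps [x0 y0] in [y0], or it starts after [y0]. *)
Fixpoint reduce u : T :=
  if u is x :: u' then
    if u' is y :: v then
      if red x y then tail x y * wd v else wd [:: x] * reduce u'
    else wd [:: x]
  else wd [::].

Lemma reduceP u : ~~ normal_word u -> exists u0 x y v,
  [/\ u = u0 ++ x :: y :: v, red x y, normal_word (u0 ++ [:: x])
    & reduce u = wd u0 * tail x y * wd v].
Proof.
elim: u => [//|x [//|y v] IHu].
rewrite (_ : normal_word (x :: y :: v) = ~~ red x y && normal_word (y :: v)) //.
rewrite (_ : reduce (x :: y :: v) =
  if red x y then tail x y * wd v else wd [:: x] * reduce (y :: v)) //.
case xy: (red x y) => nor.
  by exists [::], x, y, v; rewrite wd_nil mul1r.
have [u0 [x0 [y0 [v0 [uE x0y0 nor0 redE]]]]] := IHu nor.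
exists (x :: u0), x0, y0, v0; split=> //; first by rewrite uE.
- move: nor0 uE; rewrite /normal_word; case: u0 {redE} => [|z u0] /=.
    by move=> _ [<- _]; rewrite xy.
  by move=> -> [<- _]; rewrite xy.
by rewrite redE -[x :: u0]/([:: x] ++ u0) -wdM !mulrA.
Qed.

Hypothesis tail_weight : forall x y, red x y ->
  supp_in (fun u => weight u < weight [:: x; y])%N (tail x y).

Lemma tail_ctx_weight u x y v : red x y ->
  supp_in (fun w => weight w < weight (u ++ x :: y :: v))%N
          (wd u * tail x y * wd v).
Proof.
move=> xy; rewrite -mulrA.
apply: (@supp_inM _ _ _ (eq u) (fun w => weight w < weight (x :: y :: v))%N).
- by move=> _ w <-; rewrite !weight_cat ltn_add2l.
- by apply: supp_in_wd.
apply: (@supp_inM _ _ _ (fun w => weight w < weight [:: x; y])%N (eq v)).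
- move=> w _ /[swap] <-; rewrite -[x :: y :: v]/([:: x; y] ++ v) !weight_cat.
  by rewrite ltn_add2r.
- exact: tail_weight.
- by apply: supp_in_wd.
Qed.

(** Each step lowers the weight, so a number [n] of steps greater than the
    weight of the word is enough. *)
Fixpoint nf_fuel (n : nat) u : T :=
  if n is n'.+1 then
    if normal_word u then wd u else lext (nf_fuel n') (reduce u)
  else 0.

Lemma nf_fuel_stable n m u : (weight u < n)%N -> (weight u < m)%N ->
  nf_fuel n u = nf_fuel m u.
Proof.
elim: n m u => // n IHn [//|m] u un um /=; case: ifP => // /negbT.
move=> /reduceP [u0 [x [y [v [uE xy _ ->]]]]].
have := @tail_ctx_weight u0 x y v xy; move: (_ * _).
apply: supp_in_ind.
- by rewrite !linear0.
- by move=> a g h IHg IHh; rewrite !linearP /= IHg IHh.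
move=> w; rewrite -uE !lext_wd => wu.
by apply: IHn; [apply: leq_trans wu un|apply: leq_trans wu um].
Qed.

Definition nf : T -> T := lext (fun u => nf_fuel (weight u).+1 u).

HB.instance Definition _ := GRing.Linear.on nf.

Lemma nf_word u : nf (wd u) = if normal_word u then wd u else nf (reduce u).
Proof.
rewrite [nf (wd _)]lext_wd /=; case: ifP => // /negbT.
move=> /reduceP [u0 [x [y [v [uE xy _ ->]]]]].
have := @tail_ctx_weight u0 x y v xy; move: (_ * _).
apply: supp_in_ind.
- by rewrite !linear0.
- by move=> a g h IHg IHh; rewrite !linearP /= IHg IHh.
by move=> w; rewrite -uE [nf _]lext_wd lext_wd => wu; apply: nf_fuel_stable.
Qed.

(** As weights decrease, a linear relation between elements and their normal
    forms may be proved one reduction at a time. *)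
Lemma reduction_ind (Q : T -> T -> Prop) :
  Q 0 0 ->
  (forall a g g' h h', Q g g' -> Q h h' -> Q (a *: g + h) (a *: g' + h')) ->
  (forall u, normal_word u -> Q (wd u) (wd u)) ->
  (forall u x y v, red x y ->
     (forall g', Q (wd u * tail x y * wd v) g' -> Q (wd (u ++ x :: y :: v)) g')) ->
  forall g, Q g (nf g).
Proof.
move=> Q0 QD Qn Qr; apply: freeAlg_ind; first by rewrite linear0.
  by move=> a g h Qg Qh; rewrite linearP /=; apply: QD.
move=> u; have [b] := ubnP (weight u); elim: b u => // b IHb u ub.
rewrite nf_word; case: ifP => [/Qn//|/negbT].
move=> /reduceP [u0 [x [y [v [uE xy _ ->]]]]].
rewrite {1}uE; apply: Qr => //.
have := @tail_ctx_weight u0 x y v xy; move: (_ * _).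
apply: supp_in_ind.
- by rewrite linear0.
- by move=> a g h Qg Qh; rewrite linearP /=; apply: QD.
by move=> w; rewrite -uE => wu; apply: IHb; apply: leq_trans wu _.
Qed.

Lemma nf_normal g : supp_in normal_word (nf g).
Proof.
apply: (@reduction_ind (fun _ g' => supp_in normal_word g')) => //.
- exact: supp_in0.
- by move=> a _ g' _ h' ? ?; apply: supp_inD => //; apply: supp_inZ.
- by move=> u nu; apply: supp_in_wd.
Qed.

Lemma nf_id g : supp_in normal_word g -> nf g = g.
Proof.
move: g; apply: supp_in_ind => [|a g h gE hE|u nu]; first exact: linear0.
  by rewrite linearP /= gE hE.
by rewrite nf_word nu.
Qed.

Lemma nf_ideal g : two_sided_ideal relators (g - nf g).
Proof.
apply: (@reduction_ind (fun g g' => two_sided_ideal relators (g - g'))).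
- by rewrite subr0; apply: ideal_zero.
- move=> a h h' k k' hI kI; rewrite opprD addrACA -scalerBr.
  by apply: ideal_add => //; rewrite -[h - h']mul1r scalerAl; apply: ideal_mull.
- by move=> u _; rewrite subrr; apply: ideal_zero.
move=> u x y v xy g' gI.
have -> : wd (u ++ x :: y :: v) - g' =
    wd u * relator x y * wd v + (wd u * tail x y * wd v - g').
  by rewrite mulrBr mulrBl !wdM -catA addrA subrK.
by apply: ideal_add => //; apply/ideal_mulr/ideal_mull/ideal_gen; exists x, y.
Qed.

Lemma nf_supp (S : seq L -> Prop) :
  (forall u x y v, red x y -> S (u ++ x :: y :: v) ->
     supp_in S (wd u * tail x y * wd v)) ->
  forall g, supp_in S g -> supp_in S (nf g).
Proof.
move=> Sr; apply: supp_in_ind; first by rewrite linear0; apply: supp_in0.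
  by move=> a g h ? ?; rewrite linearP /=; apply: supp_inD => //; apply: supp_inZ.
move=> u; have [b] := ubnP (weight u); elim: b u => // b IHb u ub Su.
rewrite nf_word; case: ifP => [_|/negbT]; first exact: supp_in_wd.
move=> /reduceP [u0 [x [y [v [uE xy _ ->]]]]].
have := @tail_ctx_weight u0 x y v xy.
have := Sr u0 x y v xy; rewrite -uE => /(_ Su).
move: (_ * _) => g Sg gu.
have {Sg gu}: supp_in (fun w => S w /\ (weight w < weight u)%N) g.
  by move=> w gw; split; [apply: Sg|apply: gu].
move: g; apply: supp_in_ind; first by rewrite linear0; apply: supp_in0.
  by move=> a h k ? ?; rewrite linearP /=; apply: supp_inD => //; apply: supp_inZ.
by move=> w [Sw wu]; apply: IHb => //; apply: leq_trans wu _.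
Qed.

Hypothesis overlaps : forall x y z, red x y -> red y z ->
  low (weight [:: x; y; z]) (relator x y * wd [:: z] - wd [:: x] * relator y z).

(** Two reductions of the same word have equal normal forms: disjoint ones
    commute, and for overlapping ones [overlaps] applies in context.  The
    difference is in both cases a combination of relators whose leading words
    have smaller weight, to which induction applies. *)
Lemma nf_low b g : low b g -> nf g = 0.
Proof.
elim: b g => [|b IHb] g.
  by elim=> [//||a g' h _ g'0 _ h0]; rewrite ?linear0 // linearP /= g'0 h0 scaler0 addr0.
elim=> [u x y v xy ub||a g' h _ g'0 _ h0]; last 2 first.
- exact: linear0.
- by rewrite linearP /= g'0 h0 scaler0 addr0.
have {ub}IHb g' : low (weight (u ++ x :: y :: v)) g' -> nf g' = 0.
  by move=> g'low; apply: IHb; apply: lowW g'low.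
have nf_diff h k : low (weight (u ++ x :: y :: v)) (h - k) -> nf h = nf k.
  by move=> /IHb /eqP; rewrite linearB subr_eq0 => /eqP.
rewrite mulrBr mulrBl !wdM -catA /= linearB /=; apply/eqP; rewrite subr_eq0; apply/eqP.
have /reduceP [u0 [x0 [y0 [v0 [uE x0y0 nor redE]]]]] :
  ~~ normal_word (u ++ x :: y :: v) by rewrite normal_pair.
rewrite nf_word normal_pair // redE.
case: (cat_split (esym uE)) => [[c [uc vc]]|[a [c [u0E]]]]; last first.
  (* the leftmost reducible pair cannot lie to the right of another one *)
  case: c u0E => [|a' c] u0E /= [xa]; case=> ya _; move: nor.
    by rewrite u0E -catA -xa -ya /= normal_pair.
  by rewrite u0E -catA /= -xa -ya normal_pair.
case: c uc vc => [|x1 [|y1 c]] /=.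
- by rewrite cats0 => -> [-> -> ->].
- (* overlap: y0 = x *)
  move=> uc [x0x1 y0x v0E]; rewrite -x0x1 in uc.
  rewrite v0E; rewrite y0x in x0y0 *; apply: nf_diff.
  have -> : wd u0 * tail x0 x * wd (y :: v) - wd u * tail x y * wd v =
      - (wd u0 * (relator x0 x * wd [:: y] - wd [:: x0] * relator x y) * wd v).
    have -> : relator x0 x * wd [:: y] - wd [:: x0] * relator x y =
        wd [:: x0] * tail x y - tail x0 x * wd [:: y].
      by rewrite /relator mulrBl mulrBr !wdM opprB addrC addrA subrK.
    by rewrite uc -[y :: v]/([:: y] ++ v) -!wdM mulrBr mulrBl opprB !mulrA.
  apply: lowN; apply: (@lowW (weight [:: x0; x; y] + weight u0 + weight v)).
    by rewrite uc -catA /= -[x0 :: x :: y :: v]/([:: x0; x; y] ++ v) !weight_cat; lia.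
  apply: low_mulr; first by apply: supp_in_wd.
  by apply: low_mull; [apply: supp_in_wd|apply: overlaps].
(* disjoint pairs *)
move=> uc [x0x1 y0y1 v0E]; rewrite -x0x1 -y0y1 in uc; rewrite v0E.
apply: nf_diff.
have -> : wd u0 * tail x0 y0 * wd (c ++ x :: y :: v) - wd u * tail x y * wd v =
    wd u0 * tail x0 y0 * wd c * (wd [::] * relator x y * wd v) -
    wd u0 * relator x0 y0 * wd [::] * (wd c * tail x y * wd v).
  rewrite uc wd_nil mul1r mulr1 /relator -[x0 :: y0 :: c]/([:: x0; y0] ++ c).
  rewrite -[x :: y :: v]/([:: x; y] ++ v) -!wdM.
  by rewrite !(mulrBl, mulrBr) !mulrA opprB addrA subrK.
apply: lowB.
  apply: (@lowW (weight (x :: y :: v) + weight (u0 ++ x0 :: y0 :: c))).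
    by rewrite uc [in leqRHS]weight_cat addnC.
  apply: low_mull_lt; first exact: tail_ctx_weight.
  by apply: low_relator.
apply: (@lowW (weight (u0 ++ [:: x0; y0]) + weight (c ++ x :: y :: v))).
  by rewrite uc !weight_cat /weight /=; lia.
apply: low_mulr_lt; first exact: tail_ctx_weight.
by apply: low_relator.
Qed.

Lemma boundedW b c g : (b <= c)%N -> bounded b g -> bounded c g.
Proof. by move=> bc; apply: supp_inS => u; move/leq_trans; apply. Qed.

Lemma bounded_ex g : exists b, bounded b g.
Proof.
move: g; apply: freeAlg_ind => [|a g h [b gb] [c hc]|u].
- by exists 0%N; apply: supp_in0.
- exists (maxn b c); apply: supp_inD.
    by apply: supp_inZ; apply: boundedW gb; apply: leq_maxl.
  by apply: boundedW hc; apply: leq_maxr.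
by exists (weight u); apply: supp_in_wd.
Qed.

Lemma nf_ideal0 g : two_sided_ideal relators g -> nf g = 0.
Proof.
move=> gI; suff [b /nf_low//] : exists b, low b g.
elim: gI => {g} [_ [x [y [xy ->]]]||g h _ [b gb] _ [c hc]|a g _ [b gb]|a g _ [b gb]].
- exists (weight [:: x; y]).+1.
  by rewrite -[relator x y]mul1r -[1 * _]mulr1 -wd_nil; apply: low_relator.
- by exists 0%N; apply: low0.
- exists (maxn b c); apply: lowD.
    by apply: lowW gb; apply: leq_maxl.
  by apply: lowW hc; apply: leq_maxr.
- by have [c ac] := bounded_ex a; exists (b + c)%N; apply: low_mull.
by have [c ac] := bounded_ex a; exists (b + c)%N; apply: low_mulr.
Qed.

End Diamond.

(** * Descending paths in a finite ranked poset *)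

Section Paths.
Variables (d : Order.disp_t) (P : finRankedPOrderType d).
Implicit Types (u v w x : P) (e : hasse_edge P) (s : seq (hasse_edge P)).

(** Unlike [hasse_path], this includes the empty path from [v] to [v]. *)
Fixpoint descent v s w : bool :=
  if s is e :: s' then (edge_tail e == v) && descent (edge_head e) s' w
  else v == w.

Lemma descent_cat v s w s' x :
  descent v s w -> descent w s' x -> descent v (s ++ s') x.
Proof.
elim: s v => [|e s IHs] v /=; first by move=> /eqP ->.
by move=> /andP[-> /= /IHs]; apply.
Qed.

Lemma descentE e s v w : descent v (e :: s) w =
  [&& edge_tail e == v, hasse_path e s & edge_head (last e s) == w].
Proof.
rewrite /=; congr (_ && _); elim: s e => [//|f s IHs] e /=.
by rewrite IHs /hasse_path /= [edge_tail f == _]eq_sym andbA.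
Qed.

Lemma descent_rank v s w : descent v s w -> rank v = (rank w + size s)%N.
Proof.
elim: s v => [|e s IHs] v /=; first by move=> /eqP ->; rewrite addn0.
move=> /andP[/eqP <- /IHs vw]; rewrite addnS -vw.
exact: rank_covers (valP e).
Qed.

(** A maximal element of the interval from [w] to [v], without [v], is covered
    by [v]. *)
Lemma lower_cover w v : (w < v)%O -> exists2 z, (w <= z)%O & covers v z.
Proof.
move=> wv; pose between := [pred x | (w <= x)%O && (x < v)%O].
have Pw : between w by rewrite /= lexx.
have [z /andP[wz zv] zmax] := arg_maxnP (fun x => #|[set y | (y <= x)%O]|) Pw.
exists z => //; rewrite /covers zv; apply/forallP => r; apply/implyP.
move=> /andP[zr rv]; have [->|r_neq_v] := eqVneq r v; first by rewrite orbT.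
have /zmax : between r by rewrite /= (le_trans wz zr) lt_neqAle r_neq_v.
have sub : [set y | (y <= z)%O] \subset [set y | (y <= r)%O].
  by apply/subsetP => y; rewrite !inE => /le_trans; apply.
move=> card_le; have /eqP/setP/(_ r) : [set y | (y <= z)%O] == [set y | (y <= r)%O].
  by rewrite eqEcard sub.
by rewrite !inE lexx orbF => rz; rewrite eq_le zr rz.
Qed.

Lemma descent_ex w v : (w <= v)%O -> exists s, descent v s w.
Proof.
have [n] := ubnP #|[set y | (y <= v)%O]|; elim: n v => // n IHn v vn.
rewrite le_eqVlt => /predU1P[->|wv]; first by exists [::]; rewrite /= eqxx.
have [z wz vz] := lower_cover wv.
have zv : (z < v)%O by case/andP: vz.
have [|s zsw] := IHn z _ wz.
  rewrite ltnS in vn; apply: leq_trans vn; apply: proper_card; apply/properP; split.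
    by apply/subsetP => y; rewrite !inE => /le_trans; apply; apply: ltW.
  by exists v; rewrite !inE ?lexx // (lt_geF zv).
by exists ((Sub (v, z) vz : hasse_edge P) :: s); rewrite /= zsw eqxx.
Qed.

Lemma rank_lt w v : (w < v)%O -> (rank w < rank v)%N.
Proof.
move=> wv; have [s vsw] := descent_ex (ltW wv).
rewrite (descent_rank vsw); case: s vsw => [/eqP vw|e s _]; last by rewrite /= addnS ltnS leq_addr.
by rewrite vw ltxx in wv.
Qed.

Lemma descent_le v s w : descent v s w -> (w <= v)%O.
Proof.
elim: s v => [|e s IHs] v /=; first by move=> /eqP ->.
move=> /andP[/eqP <- /IHs/le_trans]; apply; apply: ltW.
by have /andP[] := valP e.
Qed.

Lemma descent_aut (sigma : poset_aut P) v s w :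
  descent (sigma v) (map (edge_aut sigma) s) (sigma w) = descent v s w.
Proof.
elim: s v => [|e s IHs] v /=; first by rewrite (inj_eq perm_inj).
by rewrite -IHs edge_tail_aut edge_head_aut (inj_eq perm_inj).
Qed.

Variables (bot : P) (bot_le : forall v, (bot <= v)%O).

Lemma rank_bot : rank bot = 0%N.
Proof. by apply/rank_minimal => q qb; apply/le_anti; rewrite qb bot_le. Qed.

Lemma aut_bot (sigma : poset_aut P) : sigma bot = bot.
Proof.
apply/le_anti; rewrite bot_le andbT.
by rewrite -{2}(permKV sigma bot) poset_autP bot_le.
Qed.

(** The rank is the length of the paths to the bottom. *)
Lemma aut_rank (sigma : poset_aut P) v : rank (sigma v) = rank v.
Proof.
have [s vs] := descent_ex (bot_le v); rewrite (descent_rank vs).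
move: vs; rewrite -(descent_aut sigma) aut_bot => /descent_rank ->.
by rewrite size_map.
Qed.

Definition descent_to_bot v : seq (hasse_edge P) := xchoose (descent_ex (bot_le v)).

Lemma descent_to_botP v : descent v (descent_to_bot v) bot.
Proof. exact: (xchooseP (descent_ex (bot_le v))). Qed.

End Paths.

(** * Right division of power series over a noncommutative ring *)

Section SeriesDivision.
Variable R : nzRingType.
Implicit Types f g : {poly R}.

Fixpoint rquot_prefix f g (n : nat) : seq R :=
  if n is n'.+1 then
    let q := rquot_prefix f g n' in
    rcons q (f`_n' - \sum_(j < n') q`_j * g`_(n' - j))
  else [::].

(** When [g] has constant coefficient 1, the power series with these
    coefficients is the one whose product with [g] is [f]. *)
Definition rquot f g n : R := (rquot_prefix f g n.+1)`_n.

Lemma rquotE f g n :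
  rquot f g n = f`_n - \sum_(j < n) rquot f g j * g`_(n - j).
Proof.
have sz k : size (rquot_prefix f g k) = k.
  by elim: k => //= k IHk; rewrite size_rcons IHk.
have nthE k i : (i < k)%N -> (rquot_prefix f g k)`_i = rquot f g i.
  elim: k => // k IHk; rewrite ltnS leq_eqVlt => /predU1P[-> //|ik].
  by rewrite /= nth_rcons sz ik IHk.
rewrite {1}/rquot /= nth_rcons sz ltnn eqxx; congr (_ - _).
by apply: eq_bigr => j _; rewrite nthE.
Qed.

Lemma rquotP f g n : g`_0 = 1 ->
  \sum_(j < n.+1) rquot f g j * g`_(n - j) = f`_n.
Proof.
by move=> g0; rewrite big_ord_recr /= subnn g0 mulr1 [rquot f g n]rquotE addrC subrK.
Qed.

Lemma rquot_unique f g (q : nat -> R) n : g`_0 = 1 ->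
  (forall i, (i <= n)%N -> \sum_(j < i.+1) q j * g`_(i - j) = f`_i) ->
  q n = rquot f g n.
Proof.
move=> g0; elim/ltn_ind: n => n IHn qE.
rewrite rquotE -(qE n) // big_ord_recr /= subnn g0 mulr1 addrC.
rewrite [X in _ - X](eq_bigr (fun j : 'I_n => q j * g`_(n - j))) ?addrK // => j _.
by rewrite -IHn // => i ij; apply: qE; apply: leq_trans ij _; apply: ltnW.
Qed.

End SeriesDivision.

(** * Vertex polynomials and the reduction system *)

(** The weight of a letter [(v, k)], where [r] is the rank of [v], is one more
    than twice the sum of the ranks of the first [k] vertices on a path from
    [v].  Concatenating paths adds these sums, so that [(v, k) (w, l)] exceeds
    [(v, k + l)] by one when [w] lies [k] steps below [v]; leaving the path from
    [v] for lower vertices costs at least two at each step. *)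
Definition lweight (r k : nat) : nat := (k * (r.*2.+1 - k)).+1.

Arguments lweight r%_N k%_N.

Lemma lweight_add r k j : (k + j <= r)%N ->
  (lweight r (k + j)).+1 = (lweight r k + lweight (r - k) j)%N.
Proof.
move=> kjr; rewrite /lweight addSn addnS; congr _.+2.
have [t ->] : exists t, r = (k + j + t)%N by exists (r - (k + j))%N; lia.
have -> : ((k + j + t).*2.+1 - (k + j) = k + j + t.*2.+1)%N by lia.
have -> : ((k + j + t).*2.+1 - k = k + (j + t.*2.+1) + j)%N by lia.
have -> : ((k + j + t - k).*2.+1 - j = j + t.*2.+1)%N by lia.
by nia.
Qed.

Lemma lweight_ub r k j : (lweight r (k + j) <= lweight r k + j * r.*2)%N.
Proof.
elim: j => [|j IHj]; first by rewrite addn0 leq_addr.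
apply: (@leq_trans (lweight r (k + j) + r.*2)); last by rewrite mulSn; lia.
rewrite /lweight addnS addSn ltnS; move: (k + j)%N => i.
case: (leqP i r.*2) => ir; last by rewrite (_ : r.*2.+1 - i.+1 = 0)%N ?muln0; lia.
have -> : (r.*2.+1 - i = (r.*2.+1 - i.+1).+1)%N by lia.
by rewrite mulSn mulnS; lia.
Qed.

Lemma lweight_lb r k j t : (k + j + t <= r)%N ->
  (lweight r k + j * t.*2.+2 <= lweight r (k + j))%N.
Proof.
elim: j => [|j IHj] kjt; first by rewrite addn0 mul0n addn0.
have /IHj {}IHj : (k + j + t <= r)%N by lia.
suff : (lweight r (k + j) + t.*2.+2 <= lweight r (k + j.+1))%N.
  by rewrite mulSn; lia.
have {kjt} : (k + j + t.+1 <= r)%N by lia.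
rewrite /lweight (addnS k j); move: (k + j)%N => i kjt.
have -> : (r.*2.+1 - i = (r.*2.+1 - i.+1).+1)%N by lia.
have : (t.*2.+2 + i <= r.*2.+1 - i.+1)%N by lia.
move: (r.*2.+1 - i.+1)%N => A; rewrite mulSn mulnS; lia.
Qed.

Section Letters.
Variables (F : fieldType) (d : Order.disp_t) (P : finRankedPOrderType d).
Implicit Types (v w : P).

(** The letter [(v, k)] stands for the coefficient of degree [k] of the
    polynomial, the product of the factors [1 - e X] over the edges [e], of a
    path from [v] to the bottom. *)
Definition is_letter (x : P * nat) : bool := (0 < x.2 <= rank x.1)%N.
Definition letter := {x : P * nat | is_letter x}.

Definition lvertex (x : letter) : P := (val x).1.
Definition lindex (x : letter) : nat := (val x).2.

HB.instance Definition _ := Choice.on letter.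

Variable T : freeAlg F letter.
Implicit Types x y z : letter.

Definition vcoef v k : T :=
  if insub (v, k) is Some x then wd T [:: x] else (k == 0%N)%:R.

Arguments vcoef v k%_N.

Lemma vcoef_letter x : vcoef (lvertex x) (lindex x) = wd T [:: x].
Proof. by rewrite /vcoef -surjective_pairing valK. Qed.

Lemma vcoef0 v : vcoef v 0 = 1.
Proof. by rewrite /vcoef insubF. Qed.

Lemma vcoef_big v k : (rank v < k)%N -> vcoef v k = 0.
Proof.
move=> vk; rewrite /vcoef insubF; last by rewrite /is_letter /= [(k <= _)%N]leqNgt vk andbF.
by case: k vk.
Qed.

Definition vpoly v : {poly T} := \poly_(k < (rank v).+1) vcoef v k.

Lemma coef_vpoly v k : (vpoly v)`_k = vcoef v k.
Proof. by rewrite coef_poly; case: ltnP => // vk; rewrite vcoef_big. Qed.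

(** The polynomial part of the quotient of [vpoly v] by [vpoly w], which a
    path from [v] to [w] computes in the splitting algebra. *)
Definition quopoly v w : {poly T} :=
  \poly_(i < (rank v - rank w).+1) rquot (vpoly v) (vpoly w) i.

(** Its coefficients are the relations between the letters: they say that the
    polynomial of [w] divides that of [v] on the right. *)
Definition rempoly v w : {poly T} := vpoly v - quopoly v w * vpoly w.

Lemma rempoly_low v w i : (i <= rank v - rank w)%N -> (rempoly v w)`_i = 0.
Proof.
move=> ik; rewrite coefB coefM -(@rquotP _ (vpoly v) (vpoly w)); last first.
  by rewrite coef_vpoly vcoef0.
apply/eqP; rewrite subr_eq0; apply/eqP; apply: eq_bigr => j _.
by rewrite [(quopoly v w)`_j]coef_poly (leq_trans (ltn_ord j)) // ltnS.
Qed.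

Lemma rempoly_high v w i : (rank w <= rank v)%N -> (rank v < i)%N ->
  (rempoly v w)`_i = 0.
Proof.
move=> wv vi; rewrite coefB coef_vpoly vcoef_big // sub0r coefM.
rewrite big1 ?oppr0 // => j _; rewrite [(quopoly v w)`_j]coef_poly; case: ltnP => jk; last by rewrite mul0r.
by rewrite coef_vpoly vcoef_big ?mulr0 //; lia.
Qed.

Definition reducible x y : bool :=
  (lvertex y < lvertex x)%O && (lindex x + rank (lvertex y) == rank (lvertex x))%N.

Definition reduct x y : T :=
  wd T [:: x; y] + (rempoly (lvertex x) (lvertex y))`_(lindex x + lindex y)%N.

Definition letter_weight x : nat := lweight (rank (lvertex x)) (lindex x).

Local Notation weight := (weight letter_weight).
Local Notation bounded := (bounded (T := T) letter_weight).
Local Notation low := (low reducible reduct letter_weight).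
Local Notation relator := (relator reduct).

Lemma relatorE x y :
  relator x y = - (rempoly (lvertex x) (lvertex y))`_(lindex x + lindex y)%N.
Proof. by rewrite /relator /reduct opprD addNKr. Qed.

Lemma lindex_gt0 x : (0 < lindex x)%N.
Proof. by case/andP: (valP x). Qed.

Lemma lindex_le x : (lindex x <= rank (lvertex x))%N.
Proof. by case/andP: (valP x). Qed.

Lemma vcoef_bounded v k : bounded (lweight (rank v) k) (vcoef v k).
Proof.
rewrite /vcoef; case: insubP => [x _ xE|_].
  by apply: supp_in_wd; rewrite /weight /= addn0 /letter_weight /lvertex /lindex xE.
case: eqP => _; last exact: supp_in0.
by rewrite -wd_nil; apply: supp_in_wd.
Qed.

Lemma boundedM b c (g h : T) : bounded b g -> bounded c h -> bounded (b + c)%N (g * h).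
Proof.
by apply: supp_inM => u v ub vc; rewrite weight_cat leq_add.
Qed.

Lemma quopoly_bounded_aux v w i : (rank w < rank v)%N -> (i <= rank v - rank w)%N ->
  bounded (lweight (rank v) i) (rquot (vpoly v) (vpoly w) i) /\
  supp_in (fun u => weight u < lweight (rank v) i)%N
    (rquot (vpoly v) (vpoly w) i - vcoef v i).
Proof.
move=> wv; elim/ltn_ind: i => i IHi ik.
have lt : supp_in (fun u => weight u < lweight (rank v) i)%N
    (rquot (vpoly v) (vpoly w) i - vcoef v i).
  rewrite rquotE coef_vpoly addrAC subrr sub0r; apply: supp_inN.
  apply: supp_in_sum => j _; have [|qb _] := IHi j (ltn_ord j).
    exact: leq_trans (ltnW (ltn_ord j)) ik.
  rewrite coef_vpoly; apply: (supp_inS _ (boundedM qb (@vcoef_bounded w (i - j)))).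
  move=> u; move/leq_ltn_trans; apply.
  move: (nat_of_ord j) (ltn_ord j) => {qb}j ji.
  have : (lweight (rank v) j + (i - j) * (rank w).*2.+2 <= lweight (rank v) i)%N.
    by rewrite -[in leqRHS](subnKC (ltnW ji)); apply: lweight_lb; lia.
  have : (lweight (rank w) (i - j) <= 1 + (i - j) * (rank w).*2)%N.
    exact: (lweight_ub _ 0).
  have : (0 < i - j)%N by lia.
  by move: (i - j)%N => t; rewrite !mulnS; lia.
split=> //; rewrite -[rquot _ _ _](subrK (vcoef v i)); apply: supp_inD.
  by apply: supp_inS lt => u; apply: ltnW.
exact: vcoef_bounded.
Qed.

Lemma quopoly_bounded v w i : (rank w < rank v)%N ->
  bounded (lweight (rank v) i) (quopoly v w)`_i.
Proof.
move=> wv; rewrite coef_poly ltnS; case: leqP => ik; last exact: supp_in0.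
by have [] := quopoly_bounded_aux wv ik.
Qed.

Lemma quopoly_lead v w : (rank w < rank v)%N ->
  supp_in (fun u => weight u < lweight (rank v) (rank v - rank w))%N
    ((quopoly v w)`_(rank v - rank w)%N - vcoef v (rank v - rank w)%N).
Proof.
move=> wv; rewrite coef_poly ltnS leqnn.
by have [] := quopoly_bounded_aux wv (leqnn _).
Qed.

Local Notation below c := (supp_in (fun u => weight u < c)%N).

Lemma belowM b c (g h : T) : below b g -> bounded c h -> below (b + c)%N (g * h).
Proof.
by apply: supp_inM => u v ub vc; rewrite weight_cat -addSn leq_add.
Qed.

Lemma reducible_ranks x y : reducible x y ->
  [/\ (lvertex y < lvertex x)%O, (rank (lvertex y) < rank (lvertex x))%N &
      lindex x = (rank (lvertex x) - rank (lvertex y))%N].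
Proof.
by move=> /andP[yx /eqP <-]; rewrite addnK -{1}[rank _]add0n ltn_add2r lindex_gt0.
Qed.

Lemma weight_pair x y : weight [:: x; y] = (letter_weight x + letter_weight y)%N.
Proof. by rewrite /weight /= addn0. Qed.

(** The relation of degree [k + l] between [v] and [w] consists of its leading
    word [(v, k) (w, l)], of the letter [(v, k + l)], lighter by one, and of
    words that leave the path from [v] for [w] too early. *)
Lemma reduct_weight x y : reducible x y ->
  below (weight [:: x; y]) (reduct x y).
Proof.
case/reducible_ranks=> _ wv kE; rewrite /reduct weight_pair /letter_weight.
rewrite -[wd T _]/(wd T ([:: x] ++ [:: y])) -wdM -!vcoef_letter.
have := lindex_le y; have := lindex_le x; have := lindex_gt0 x.
move: (lvertex x) (lvertex y) (lindex x) (lindex y) wv kE => v w k l wv kE k0 kv lw.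
rewrite coefB coef_vpoly coefM.
have kl : (k < (k + l).+1)%N by rewrite ltnS leq_addr.
rewrite (bigD1 (Ordinal kl)) //= addKn coef_vpoly.
set Q := (quopoly v w)`_k * _; set S := \sum_(_ < _ | _) _.
have -> : vcoef v k * vcoef w l + (vcoef v (k + l) - (Q + S)) =
    vcoef v (k + l) - S - ((quopoly v w)`_k - vcoef v k) * vcoef w l.
  rewrite mulrBl opprB addrACA opprD [in LHS]addrA.
  by rewrite [_ + vcoef v (k + l)]addrC [- Q - S]addrC.
apply: supp_inB; last first.
  by apply: belowM; [rewrite kE; exact: quopoly_lead|exact: vcoef_bounded].
apply: supp_inB.
  apply: supp_inS (@vcoef_bounded v (k + l)%N) => u; move/leq_ltn_trans; apply.
  have := @lweight_add (rank v) k l; rewrite kE; rewrite subKn ?(ltnW wv) //; lia.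
apply: supp_in_sum => i ik; rewrite coef_vpoly.
have [ki|] := ltnP k i.
  by rewrite coef_poly ltnS -kE leqNgt ki mul0r; exact: supp_in0.
rewrite leq_eqVlt (inj_eq val_inj i (Ordinal kl)) (negPf ik) /= => {}ik.
apply: (supp_inS _ (boundedM (@quopoly_bounded v w i wv)
  (@vcoef_bounded w (k + l - i)%N))) => u.
move/leq_ltn_trans; apply.
have -> : (k + l - i = l + (k - i))%N by lia.
have := lweight_ub (rank w) l (k - i).
have : (lweight (rank v) i + (k - i) * (rank w).*2.+2 <= lweight (rank v) k)%N.
  by rewrite -[in leqRHS](subnKC (ltnW ik)); apply: lweight_lb; lia.
have : (0 < k - i)%N by lia.
by move: (k - i)%N => t; rewrite !mulnS; lia.
Qed.

(** Such a coefficient is zero or, up to sign, a relator. *)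
Lemma rempoly_low_coef v w j : (w < v)%O ->
  low (lweight (rank v) (rank v - rank w) + lweight (rank w) j).+1
      (rempoly v w)`_(rank v - rank w + j)%N.
Proof.
move=> wv; have rwv := rank_lt wv.
have [->|j0] := posnP j; first by rewrite addn0 rempoly_low //; exact: low0.
have [jw|wj] := leqP j (rank w); last by rewrite rempoly_high ?(ltnW rwv) //; [exact: low0|lia].
have xl : is_letter (v, rank v - rank w)%N by rewrite /is_letter /= subn_gt0 rwv leq_subr.
have yl : is_letter (w, j) by rewrite /is_letter /= j0.
pose x : letter := Sub (v, rank v - rank w)%N xl; pose y : letter := Sub (w, j) yl.
have := relatorE x y; rewrite /lindex /lvertex /= => /esym/eqP.
rewrite eqr_oppLR => /eqP ->; apply: lowN.
rewrite -[relator x y]mul1r -[1 * _]mulr1 -wd_nil; apply: low_relator.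
  by rewrite /reducible /lindex /lvertex /= wv subnK ?eqxx // ltnW.
by rewrite /= weight_pair.
Qed.

Lemma zmod_cancel (V : zmodType) (a y s1 q p s2 r1 r2 : V) :
  a + s1 = q + s2 + r1 - r2 -> p - y = a - y + s1 - (q - p) - s2 - r1 + r2.
Proof.
move=> E; have E' : s2 + r1 - r2 = a + s1 - q.
  by apply/eqP; rewrite eq_sym subr_eq E [_ + q]addrC !addrA.
have -> (X : V) : X - s2 - r1 + r2 = X - (s2 + r1 - r2).
  by rewrite !opprD opprK !addrA.
by rewrite E' [a - y + s1]addrAC !opprB -(addrA (a + s1 - y)) subrKA addrC subrKA.
Qed.

Section Overlap.
Variables (v w x : P) (wv : (w < v)%O) (xw : (x < w)%O).
Local Notation k := (rank v - rank w)%N.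
Local Notation l := (rank w - rank x)%N.

Let rwv : (rank w < rank v)%N := rank_lt wv.
Let rxw : (rank x < rank w)%N := rank_lt xw.
Let xv : (x < v)%O := lt_trans xw wv.
Let kl : (k + l = rank v - rank x)%N. Proof. by have := rwv; have := rxw; lia. Qed.

(** The quotient from [v] to [x] and the product of those through [w] differ
    by [qdefect], whose product with the polynomial of [x] is a combination of
    remainders, [rdefect]. *)
Definition qdefect : {poly T} := quopoly v x - quopoly v w * quopoly w x.

Definition rdefect : {poly T} := quopoly v w * rempoly w x + rempoly v w - rempoly v x.

Lemma qdefectE : qdefect * vpoly x = rdefect.
Proof.
rewrite /qdefect /rdefect /rempoly mulrBr mulrBl mulrA.
by rewrite [X in _ = X - _]addrC addrA subrK opprB [RHS]addrC addrA subrK.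
Qed.

(** The only terms of [rdefect] of the greatest possible weight are in the
    remainder of [v] by [w]; each of the [s] degrees missing to [k + l] lowers
    the weight by twice a rank greater than that of [x]. *)
Lemma rdefect_low i s c : (i + s = k + l)%N ->
  (lweight (rank v) k + lweight (rank w) l <= c + s * (rank x).*2.+2)%N ->
  low c (rdefect`_i - (rempoly v w)`_i) /\ low c.+1 (rempoly v w)`_i.
Proof.
have [a b e] : [/\ rank w < rank v, rank x < rank w & k + l = rank v - rank x]%N.
  by split.
move=> is_kl hc; split.
  rewrite coefB coefD addrAC addrK.
  rewrite [(rempoly v x)`_i]rempoly_low ?subr0; last lia.
  rewrite coefM; apply: low_sum => j _.
  have [ij|lij] := leqP (i - j) l; first by rewrite [(rempoly w x)`_ _]rempoly_low // mulr0; exact: low0.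
  have := rempoly_low_coef (i - j - l)%N xw.
  rewrite subnKC ?(ltnW lij) // => /(low_mull (@quopoly_bounded v w j rwv)).
  apply: lowW.
  have jk : (j + (k - j) = k)%N by lia.
  have h1 : (lweight (rank v) j + (k - j) * (rank w).*2.+2 <= lweight (rank v) k)%N.
    by rewrite -[in leqRHS]jk; apply: lweight_lb; lia.
  have h2 := lweight_ub (rank x) 0 (i - j - l).
  have h3 : (k - j = s + (i - j - l))%N by lia.
  have h4 : ((k - j) * (rank x).*2.+4 <= (k - j) * (rank w).*2.+2)%N.
    by apply: leq_mul => //; lia.
  have h5 : (0 < i - j - l)%N by lia.
  rewrite h3 in h4; move: h1 h2 h4 h5; rewrite h3 {h3}.
  move: (i - j - l)%N hc (erefl : lweight (rank x) 0 = 1%N) => t.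
  by rewrite add0n !mulnS !mulnDl; lia.
have [ik|ki] := leqP i k; first by rewrite rempoly_low //; exact: low0.
have -> : (i = k + (i - k))%N by lia.
apply: lowW (rempoly_low_coef (i - k)%N wv); rewrite ltnS.
have : (lweight (rank w) (i - k) + s * (rank x).*2.+2 <= lweight (rank w) l)%N.
  by rewrite (_ : l = i - k + s)%N; [apply: lweight_lb|]; lia.
lia.
Qed.

Lemma lead_gt s : (s <= k + l)%N ->
  (s * (rank x).*2.+2 < lweight (rank v) k + lweight (rank w) l)%N.
Proof.
move=> skl; have h1 : (1 + k * (rank x).*2.+2 <= lweight (rank v) k)%N.
  by apply: (@lweight_lb _ 0); have := rwv; have := rxw; lia.
have h2 : (1 + l * (rank x).*2.+2 <= lweight (rank w) l)%N.
  by apply: (@lweight_lb _ 0); have := rxw; lia.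
have : (s * (rank x).*2.+2 <= (k + l) * (rank x).*2.+2)%N by apply: leq_mul.
by move: h1 h2; rewrite [((k + l) * _)%N]mulnDl; lia.
Qed.

(** Solving [qdefectE] for [qdefect] only introduces letters at [x], which are
    lighter than the degrees that they fill. *)
Lemma qdefect_low i s c : (i + s = k + l)%N ->
  (lweight (rank v) k + lweight (rank w) l <= c + s * (rank x).*2.+2)%N ->
  low c.+1 qdefect`_i /\ low c (qdefect`_i - (rempoly v w)`_i).
Proof.
elim/ltn_ind: i s c => i IHi s c is_kl hc.
have [lt_c le_c] := rdefect_low is_kl hc.
suff lt_d : low c (qdefect`_i - rdefect`_i).
  have {lt_d}lt_d : low c (qdefect`_i - (rempoly v w)`_i).
    by rewrite -[_ - (rempoly v w)`_i](subrKA rdefect`_i); apply: lowD.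
  split=> //; rewrite -[qdefect`_i](subrK (rempoly v w)`_i); apply: lowD => //.
  exact: lowW lt_d.
rewrite -qdefectE coefM big_ord_recr /= subnn coef_vpoly vcoef0 mulr1.
rewrite opprD addrCA subrr addr0; apply: lowN; apply: low_sum => j _.
rewrite coef_vpoly; move: (nat_of_ord j) (ltn_ord j) => {}j ji.
have hs : (s + (i - j) + j = k + l)%N by lia.
have hub := lweight_ub (rank x) 0 (i - j).
have hlb : ((s + (i - j)) * (rank x).*2.+2 < lweight (rank v) k + lweight (rank w) l)%N.
  by apply: lead_gt; lia.
have [||dj _] := IHi j ji (s + (i - j))%N (c - (i - j) * (rank x).*2.+2)%N; first lia.
  by move: hlb hc; rewrite !mulnDl; lia.
apply: lowW (low_mulr (@vcoef_bounded x (i - j)%N) dj).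
move: hlb hc hub (erefl : lweight (rank x) 0 = 1%N).
have : (0 < i - j)%N by lia.
by rewrite add0n !mulnDl !mulnS; lia.
Qed.


Lemma qdefect_high i : (k + l < i)%N -> qdefect`_i = 0.
Proof.
move=> kli; rewrite coefB coef_poly ltnS -kl leqNgt kli sub0r coefM.
rewrite big1 ?oppr0 // => j _; rewrite !coef_poly !ltnS.
case: leqP => [jk|]; last by rewrite mul0r.
by case: leqP => [|]; [lia|rewrite mulr0].
Qed.

(** Both sides of the overlap occur in the coefficient of degree [k + l + m] of
    [qdefectE], all other terms of which have smaller weight. *)
Lemma rempoly_overlap m :
  low (lweight (rank v) k + lweight (rank w) l + lweight (rank x) m)
      (vcoef v k * (rempoly w x)`_(l + m)%N - (rempoly v w)`_(k + l)%N * vcoef x m).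
Proof.
have := congr1 (fun p : {poly T} => p`_(k + l + m)%N) qdefectE.
rewrite coefB coefD !coefM.
have lt1 : (k + l < (k + l + m).+1)%N by lia.
have lt2 : (k < (k + l + m).+1)%N by lia.
rewrite (bigD1 (Ordinal lt1)) // [in RHS](bigD1 (Ordinal lt2)) //=.
rewrite addKn coef_vpoly (_ : k + l + m - k = l + m)%N; last lia.
set S1 := \sum_(i < _ | i != Ordinal lt1) _.
set S2 := \sum_(i < _ | i != Ordinal lt2) _.
move=> E.
have -> : vcoef v k * (rempoly w x)`_(l + m)%N - (rempoly v w)`_(k + l)%N * vcoef x m =
   (qdefect`_(k + l)%N - (rempoly v w)`_(k + l)%N) * vcoef x m + S1
   - ((quopoly v w)`_k - vcoef v k) * (rempoly w x)`_(l + m)%N - S2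
   - (rempoly v w)`_(k + l + m)%N + (rempoly v x)`_(k + l + m)%N.
  by rewrite !mulrBl; apply: zmod_cancel.
have [hk hl] : (rank v = k + rank w)%N /\ (rank w = l + rank x)%N.
  by have := rwv; have := rxw; lia.
have wt_m : (0 < lweight (rank x) m)%N by [].
apply: lowD; last first.
  have [mx|xm] := leqP m (rank x); last first.
    rewrite rempoly_high; [exact: low0|exact: ltnW (rank_lt xv)|lia].
  rewrite kl; apply: lowW (rempoly_low_coef m xv); rewrite -kl.
  have := @lweight_add (rank v) k l; have := rwv; have := rxw.
  rewrite (_ : rank v - k = rank w)%N; lia.
apply: lowB; last first.
  have [mx|xm] := leqP m (rank x); last first.
    rewrite rempoly_high; [exact: low0|exact: ltnW rwv|lia].
  rewrite -(addnA k); apply: lowW (rempoly_low_coef (l + m)%N wv).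
  have := @lweight_add (rank w) l m.
  rewrite (_ : rank w - l = rank x)%N; lia.
apply: lowB; last first.
  apply: low_sum => i ik; have [ki|] := ltnP k i.
    by rewrite coef_poly ltnS leqNgt ki mul0r; exact: low0.
  rewrite leq_eqVlt (inj_eq val_inj i (Ordinal lt2)) (negPf ik) /= => {}ik.
  rewrite (_ : k + l + m - i = l + (m + (k - i)))%N; last lia.
  apply: lowW (low_mull (@quopoly_bounded v w i rwv) (rempoly_low_coef (m + (k - i))%N xw)).
  have h1 : (lweight (rank v) i + (k - i) * (rank w).*2.+2 <= lweight (rank v) k)%N.
    by rewrite -[in leqRHS](subnKC (ltnW ik)); apply: lweight_lb; have := rwv; lia.
  have h2 := lweight_ub (rank x) m (k - i).
  have h3 : ((k - i) * (rank x).*2.+2 <= (k - i) * (rank w).*2)%N.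
    by apply: leq_mul => //; have := rxw; lia.
  have : (0 < k - i)%N by lia.
  by move: h1 h2 h3; rewrite !mulnS; lia.
apply: lowB; last first.
  apply: lowW (low_mull_lt (quopoly_lead rwv) (rempoly_low_coef m xw)); lia.
apply: lowD.
  have [] := @qdefect_low (k + l) 0 (lweight (rank v) k + lweight (rank w) l)%N.
  - by rewrite addn0.
  - by rewrite mul0n addn0.
  by move=> _ h; apply: low_mulr h; apply: vcoef_bounded.
apply: low_sum => i ikl; have [ki|] := ltnP (k + l) i.
  by rewrite qdefect_high // mul0r; exact: low0.
rewrite leq_eqVlt (inj_eq val_inj i (Ordinal lt1)) (negPf ikl) /= => {}ikl.
rewrite coef_vpoly (_ : k + l + m - i = m + (k + l - i))%N; last lia.
pose c := (lweight (rank v) k + lweight (rank w) l - (k + l - i) * (rank x).*2.+2)%N.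
have lead := @lead_gt (k + l - i)%N (leq_subr _ _).
have [||di _] := @qdefect_low i (k + l - i)%N c.
- by rewrite subnKC // ltnW.
- by rewrite /c; lia.
apply: lowW (low_mulr (@vcoef_bounded x (m + (k + l - i))%N) di).
have := lweight_ub (rank x) m (k + l - i); have : (0 < k + l - i)%N by lia.
by move: lead; rewrite /c !mulnS; lia.
Qed.

End Overlap.

Lemma relator_overlap x y z : reducible x y -> reducible y z ->
  low (weight [:: x; y; z]) (relator x y * wd T [:: z] - wd T [:: x] * relator y z).
Proof.
move=> /reducible_ranks [yx _ kE] /reducible_ranks [zy _ lE].
have -> : relator x y * wd T [:: z] - wd T [:: x] * relator y z =
    vcoef (lvertex x) (lindex x) *
      (rempoly (lvertex y) (lvertex z))`_(lindex y + lindex z)%N -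
    (rempoly (lvertex x) (lvertex y))`_(lindex x + lindex y)%N *
      vcoef (lvertex z) (lindex z).
  by rewrite !relatorE !vcoef_letter mulrN mulNr opprK addrC.
rewrite /weight /= addn0 addnA /letter_weight kE lE.
exact: rempoly_overlap.
Qed.

Definition normal_form : T -> T := nf reducible reduct letter_weight.

Lemma normal_form_ideal0 (g : T) :
  two_sided_ideal (relators reducible reduct) g -> normal_form g = 0.
Proof. by apply: nf_ideal0; [exact: reduct_weight|exact: relator_overlap]. Qed.

End Letters.

(** * The splitting algebra and its vertex coefficients *)

Lemma ideal_eq0 (R : pzRingType) (g : R) : two_sided_ideal (eq 0) g -> g = 0.
Proof.
elim=> {g} [//|//|x y _ -> _ ->|a x _ ->|a x _ ->]; first exact: addr0.
  exact: mulr0.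
exact: mul0r.
Qed.

Lemma morph_ext (F : fieldType) (L : choiceType) (T : freeAlg F L)
    (B : algType F) (f1 f2 : {lrmorphism T -> B}) :
  (forall x, f1 (wd T [:: x]) = f2 (wd T [:: x])) -> f1 =1 f2.
Proof.
move=> fx g; apply/eqP; rewrite -subr_eq0; apply/eqP/ideal_eq0.
by apply: ideal_morph_ext => x; rewrite fx subrr; apply: ideal_zero.
Qed.

Lemma rquot_map (R S : nzRingType) (f : {rmorphism R -> S}) (p q : {poly R}) n :
  f (rquot p q n) = rquot (map_poly f p) (map_poly f q) n.
Proof.
elim/ltn_ind: n => n IHn; rewrite !rquotE rmorphB rmorph_sum coef_map.
by congr (_ - _); apply: eq_bigr => j _; rewrite rmorphM /= IHn // coef_map.
Qed.

Section PathPolynomials.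
Variables (R : nzRingType) (d : Order.disp_t) (P : finRankedPOrderType d).
Local Notation E := (hasse_edge P).
Variable a : E -> R.
Implicit Types (e : E) (s : seq E).

Definition ppath s : {poly R} := \prod_(e <- s) ('X - (a e)%:P).

(** The reciprocal of [ppath], whose coefficient of degree [i] is homogeneous
    of degree [i] in the edges. *)
Definition rpath s : {poly R} := \prod_(e <- s) (1 - (a e)%:P * 'X).

Lemma rpath_cons e s i : (rpath (e :: s))`_i =
  (rpath s)`_i - (if i is j.+1 then a e * (rpath s)`_j else 0).
Proof.
rewrite /rpath big_cons mulrBl mul1r -mulrA coefB coefCM coefXM.
by case: i => [|i] //=; rewrite mulr0.
Qed.

Lemma rpath_cat s s' : rpath (s ++ s') = rpath s * rpath s'.
Proof. by rewrite /rpath big_cat. Qed.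

Lemma rpath0 s : (rpath s)`_0 = 1.
Proof.
elim: s => [|e s IHs]; first by rewrite /rpath big_nil coef1.
by rewrite rpath_cons subr0.
Qed.

Lemma rpath_high s i : (size s < i)%N -> (rpath s)`_i = 0.
Proof.
elim: s i => [|e s IHs] [|i] //=; first by rewrite /rpath big_nil coef1.
by rewrite ltnS rpath_cons => si; rewrite !IHs ?mulr0 ?subr0 // ltnW.
Qed.

Lemma ppath_high s i : (size s < i)%N -> (ppath s)`_i = 0.
Proof.
elim: s i => [|e s IHs] [|i] //=; first by rewrite /ppath big_nil coef1.
rewrite ltnS /ppath big_cons mulrBl coefB coefCM coefXM /= => si.
by rewrite !IHs ?mulr0 ?subr0 // ltnW.
Qed.

Lemma rpath_ppath s i j : (i + j = size s)%N -> (rpath s)`_i = (ppath s)`_j.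
Proof.
elim: s i j => [|e s IHs] i j /=.
  by case: i j => [|//] [|//] _; rewrite /rpath /ppath !big_nil.
rewrite rpath_cons /ppath big_cons mulrBl coefB coefCM coefXM -/(ppath s).
case: i j => [|i] [|j] //=.
- rewrite add0n => -[->]; rewrite (ppath_high (ltnSn _)) mulr0.
  by rewrite (IHs 0%N (size s)).
- rewrite addn0 => -[->]; rewrite (rpath_high (ltnSn _)).
  by rewrite (IHs (size s) 0%N) ?addn0.
by rewrite addSn addnS => -[ij]; rewrite (IHs _ j) ?(IHs _ j.+1) // addnS.
Qed.

End PathPolynomials.

Lemma map_rpath (R S : nzRingType) (f : {rmorphism R -> S})
    (d : Order.disp_t) (P : finRankedPOrderType d) (a : hasse_edge P -> R) s :
  map_poly f (rpath a s) = rpath (f \o a) s.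
Proof.
rewrite /rpath rmorph_prod; apply: eq_bigr => e _.
by rewrite rmorphB rmorphM /= rmorph1 map_polyX map_polyC.
Qed.

(** The splitting algebra [A], given by any morphism [pi] from a free algebra
    on the edges whose kernel is generated by the defining relations. *)
Section Presentation.
Variables (F : fieldType) (d : Order.disp_t) (P : finRankedPOrderType d).
Local Notation E := (hasse_edge P).
Variables (U : freeAlg F E) (A : algType F) (pi : {lrmorphism U -> A}).
Local Notation edge e := (wd U [:: e]).
Implicit Types (e : E) (s : seq E) (v w : P).

Definition path_relator (g : U) : Prop :=
  exists e1 s1 e2 s2 i,
    [/\ hasse_path e1 s1, hasse_path e2 s2, path_equiv e1 s1 e2 s2
      & g = (ppath (fun e => edge e) (e1 :: s1))`_i -
            (ppath (fun e => edge e) (e2 :: s2))`_i].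

Hypothesis pi_kernel : forall g, pi g = 0 <-> two_sided_ideal path_relator g.

Definition epath s : {poly U} := rpath (fun e => edge e) s.

(** The reciprocal polynomials satisfy the defining relations as well, because
    paths with equal ends have equal lengths. *)
Lemma epath_equiv v w s s' i : descent v s w -> descent v s' w ->
  pi (epath s)`_i = pi (epath s')`_i.
Proof.
move=> vsw vs'w; have szE : size s = size s'.
  by apply/eqP; rewrite -(eqn_add2l (rank w)) -(descent_rank vsw) (descent_rank vs'w).
have [is_le|is_gt] := leqP i (size s); last by rewrite !rpath_high // -szE.
rewrite /epath (@rpath_ppath _ _ _ _ s i (size s - i)%N) ?subnKC //.
rewrite (@rpath_ppath _ _ _ _ s' i (size s - i)%N) -?szE ?subnKC //.
case: s s' szE vsw vs'w is_le => [|e s] [|e' s'] // _.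
rewrite !descentE => /and3P[/eqP ev es /eqP ew].
move=> /and3P[/eqP e'v es' /eqP e'w] _.
apply/eqP; rewrite -subr_eq0 -rmorphB; apply/eqP/pi_kernel.
apply: ideal_gen; exists e, s, e', s'; eexists; split=> //.
by split; [rewrite ev e'v|rewrite ew e'w].
Qed.

Variables (bot : P) (bot_le : forall v, (bot <= v)%O).
Variable T : freeAlg F (letter P).
Implicit Types x y : letter P.
Local Notation dpath := (descent_to_bot bot_le).
Local Notation vpoly := (@vpoly F d P T).
Local Notation quopoly := (@quopoly F d P T).
Local Notation rempoly := (@rempoly F d P T).
Local Notation relators := (relators (@reducible d P) (@reduct F d P T)).
Local Notation inI := (two_sided_ideal relators).

(** A letter is a coefficient along a chosen path, and an edge is a difference
    of two letters of degree 1.  This describes the splitting algebra by the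
    letters and the relations [rempoly]: [theta] and [phi] induce inverse
    isomorphisms. *)
Definition theta : T -> U :=
  aext (fun x => (epath (dpath (lvertex x)))`_(lindex x)).
Definition phi : U -> T :=
  aext (fun e => vcoef T (edge_head e) 1 - vcoef T (edge_tail e) 1).
HB.instance Definition _ := GRing.LRMorphism.on theta.
HB.instance Definition _ := GRing.LRMorphism.on phi.

Lemma theta_letter x : theta (wd T [:: x]) = (epath (dpath (lvertex x)))`_(lindex x).
Proof. by rewrite /theta aext_wd big_seq1. Qed.

Lemma phi_edge e :
  phi (edge e) = vcoef T (edge_head e) 1 - vcoef T (edge_tail e) 1.
Proof. by rewrite /phi aext_wd big_seq1. Qed.

Definition psi : T -> A := pi \o theta.
HB.instance Definition _ := GRing.LRMorphism.on psi.

Lemma theta_vcoef v k : theta (vcoef T v k) = (epath (dpath v))`_k.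
Proof.
have sz : size (dpath v) = rank v.
  by rewrite (descent_rank (descent_to_botP bot_le v)) rank_bot.
rewrite /vcoef; case: insubP => [x _ xE|].
  by rewrite theta_letter /lvertex /lindex xE.
rewrite /is_letter /=; case: k => [_|k]; first by rewrite rmorph1 /epath rpath0.
rewrite /= -ltnNge => vk; rewrite rmorph0 /epath rpath_high //.
by rewrite sz.
Qed.

Lemma map_psi_vpoly v : map_poly psi (vpoly v) = map_poly pi (epath (dpath v)).
Proof.
by apply/polyP => k; rewrite !coef_map coef_vpoly -theta_vcoef.
Qed.

Lemma map_pi_epath v w s : descent v s w ->
  map_poly pi (epath (dpath v)) =
  map_poly pi (epath s) * map_poly pi (epath (dpath w)).
Proof.
move=> vsw; rewrite -rmorphM /epath -rpath_cat; apply/polyP => i.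
rewrite !coef_map; apply: (epath_equiv (v := v) (w := bot)).
  exact: descent_to_botP.
exact: descent_cat vsw (descent_to_botP _ _).
Qed.

(** By uniqueness of the division, the quotient from [v] to [w] becomes the
    polynomial of any path from [v] to [w]. *)
Lemma map_psi_quopoly v w s : descent v s w ->
  map_poly psi (quopoly v w) = map_poly pi (epath s).
Proof.
move=> vsw; have sz : (rank v - rank w = size s)%N.
  by rewrite (descent_rank vsw) addKn.
apply/polyP => i; rewrite !coef_map coef_poly sz ltnS.
case: leqP => [si|si]; last by rewrite /epath rpath_high // !raddf0.
rewrite /= [psi (rquot _ _ _)]rquot_map !map_psi_vpoly; apply/esym.
apply: (rquot_unique (q := fun i => pi (epath s)`_i)).
  by rewrite coef_map /epath rpath0 /= rmorph1.
move=> {si}i _; rewrite (map_pi_epath vsw) coefM.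
by apply: eq_bigr => j _; rewrite !coef_map.
Qed.

Lemma psi_rempoly v w : (w <= v)%O -> map_poly psi (rempoly v w) = 0.
Proof.
move=> /descent_ex [s vsw]; rewrite rmorphB rmorphM /= (map_psi_quopoly vsw).
by rewrite !map_psi_vpoly (map_pi_epath vsw) subrr.
Qed.

Lemma psi_ideal (g : T) : inI g -> psi g = 0.
Proof.
elim=> {g} [_ [x [y [/andP[yx _] ->]]]||g h _ g0 _ h0|a g _ g0|a g _ g0].
- rewrite relatorE rmorphN /= -coef_map psi_rempoly ?coef0 ?oppr0 //.
  exact: ltW.
- exact: rmorph0.
- by rewrite rmorphD /= g0 h0 addr0.
- by rewrite rmorphM /= g0 mulr0.
by rewrite rmorphM /= g0 mul0r.
Qed.

Lemma psi_phi (g : U) : psi (phi g) = pi g.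
Proof.
have psi_phi_lr : psi \o phi =1 pi.
  apply: morph_ext => e; rewrite /= phi_edge rmorphB /=.
  have vsw : descent (edge_tail e) [:: e] (edge_head e) by rewrite /= !eqxx.
  have := congr1 (fun p : {poly A} => p`_1) (map_pi_epath vsw).
  rewrite -rmorphM !coef_map /= => E1.
  have psiE v k : psi (vcoef T v k) = pi (epath (dpath v))`_k.
    by rewrite -theta_vcoef.
  rewrite !psiE E1 /epath -rpath_cat rpath_cons rpath0 mulr1.
  by rewrite rmorphB opprB addrCA subrr addr0.
exact: psi_phi_lr.
Qed.

Local Notation polyI := (fun p : {poly T} => forall i, inI p`_i).

Lemma idealN (g : T) : inI g -> inI (- g).
Proof. by rewrite -mulN1r; apply: ideal_mull. Qed.

Lemma polyID (p q : {poly T}) : polyI p -> polyI q -> polyI (p + q).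
Proof. by move=> pI qI i; rewrite coefD; apply: ideal_add. Qed.

Lemma polyIN (p : {poly T}) : polyI p -> polyI (- p).
Proof. by move=> pI i; rewrite coefN; apply: idealN. Qed.

Lemma ideal_sum (I : Type) (r : seq I) (f : I -> T) :
  (forall i, inI (f i)) -> inI (\sum_(i <- r) f i).
Proof.
by move=> fI; apply: big_ind => //; [exact: ideal_zero|exact: ideal_add].
Qed.

Lemma polyI_mull (q p : {poly T}) : polyI p -> polyI (q * p).
Proof.
by move=> pI i; rewrite coefM; apply: ideal_sum => j; apply: ideal_mull.
Qed.

Lemma polyI_cancel (p q : {poly T}) : q`_0 = 1 -> polyI (p * q) -> polyI p.
Proof.
move=> q0 pqI; elim/ltn_ind => i IHi; have := pqI i.
rewrite coefM big_ord_recr /= subnn q0 mulr1 => sumI.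
have -> : p`_i = (\sum_(j < i) p`_j * q`_(i - j) + p`_i) -
                 \sum_(j < i) p`_j * q`_(i - j) by rewrite addrAC subrr add0r.
apply: ideal_add => //; apply: idealN; apply: ideal_sum => j.
by apply: ideal_mulr; apply: IHi.
Qed.

Lemma quopoly_refl v : quopoly v v = 1.
Proof.
apply/polyP => i; rewrite coef_poly subnn ltnS leqn0 coef1.
by case: eqP => // ->; rewrite rquotE big_ord0 subr0 coef_vpoly vcoef0.
Qed.

Lemma rempoly_ideal v w : (w <= v)%O -> polyI (rempoly v w).
Proof.
rewrite le_eqVlt => /predU1P[->|wv] i.
  by rewrite /rempoly quopoly_refl mul1r subrr coef0; apply: ideal_zero.
have [ik|/ltnW ki] := leqP i (rank v - rank w).
  by rewrite rempoly_low //; apply: ideal_zero.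
rewrite -(subnKC ki).
exact: (low_ideal (rempoly_low_coef T (i - (rank v - rank w)) wv)).
Qed.

(** The product of the defect with the polynomial of [z] is a combination of
    remainders by [qdefectE], and that polynomial is invertible as a series. *)
Lemma quopoly_mul v w z : (w <= v)%O -> (z <= w)%O ->
  polyI (quopoly v w * quopoly w z - quopoly v z).
Proof.
move=> wv zw; rewrite -opprB; apply: polyIN.
apply: (@polyI_cancel _ (vpoly z)); first by rewrite coef_vpoly vcoef0.
rewrite [_ * vpoly z](qdefectE T v w z) /rdefect; apply: polyID.
  apply: polyID; last exact: rempoly_ideal.
  by apply: polyI_mull; apply: rempoly_ideal.
by apply: polyIN; apply: rempoly_ideal; apply: le_trans wv.
Qed.

Lemma quopoly_edge e : quopoly (edge_tail e) (edge_head e) =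
  1 - (phi (edge e))%:P * 'X.
Proof.
have ranks : (rank (edge_tail e) - rank (edge_head e) = 1)%N.
  have -> : rank (edge_tail e) = (rank (edge_head e)).+1.
    exact: rank_covers (valP e).
  by rewrite subSn ?subnn.
apply/polyP => i; rewrite coef_poly ranks coefB coef1 coefCM coefX.
case: i => [|[|i]] /=; last by rewrite mulr0 subr0.
  by rewrite rquotE big_ord0 coef_vpoly vcoef0 mulr0.
rewrite rquotE big_ord1 rquotE big_ord0 !coef_vpoly vcoef0 subr0 mul1r.
by rewrite sub0r mulr1 phi_edge opprB.
Qed.

Lemma phi_epath v w s : descent v s w ->
  polyI (map_poly phi (epath s) - quopoly v w).
Proof.
rewrite /epath map_rpath; elim: s v => [|e s IHs] v.
  move=> /eqP <- i; rewrite quopoly_refl /rpath big_nil subrr coef0.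
  exact: ideal_zero.
move=> /=/andP[/eqP <- es]; rewrite /rpath big_cons -/(rpath _ s).
have ev : (edge_head e <= edge_tail e)%O by apply: ltW; have /andP[] := valP e.
rewrite -quopoly_edge -[X in X - _](subrK (quopoly (edge_tail e) (edge_head e) *
  quopoly (edge_head e) w)) -mulrBr -addrA; apply: polyID.
  by apply: polyI_mull; apply: IHs.
by apply: quopoly_mul => //; apply: descent_le es.
Qed.

(** Modulo the relations between letters, [phi] maps the polynomial of a path
    to a quotient that depends on its ends only. *)
Lemma phi_ideal (g : U) : pi g = 0 -> inI (phi g).
Proof.
move/pi_kernel; elim=> {g}.
- move=> _ [e1 [s1 [e2 [s2 [i [p1 p2 [eqt eqh] ->]]]]]]; rewrite rmorphB.
  have d1 : descent (edge_tail e1) (e1 :: s1) (edge_head (last e1 s1)).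
    by rewrite descentE p1 !eqxx.
  have d2 : descent (edge_tail e1) (e2 :: s2) (edge_head (last e1 s1)).
    by rewrite descentE p2 eqt eqh !eqxx.
  have sz : size (e2 :: s2) = size (e1 :: s1).
    apply/eqP; rewrite -(eqn_add2l (rank (edge_head (last e1 s1)))).
    by rewrite -(descent_rank d1) -(descent_rank d2).
  have [i_le|i_gt] := leqP i (size (e1 :: s1)); last first.
    by rewrite !ppath_high ?sz // rmorph0 subrr; apply: ideal_zero.
  rewrite -!(@rpath_ppath _ _ _ _ _ (size (e1 :: s1) - i)%N) ?sz ?subnK //.
  rewrite -(subrKA (quopoly (edge_tail e1) (edge_head (last e1 s1)))`_(size (e1 :: s1) - i)%N).
  apply: ideal_add.
    by have := phi_epath d1 (size (e1 :: s1) - i)%N; rewrite coefB coef_map.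
  rewrite -opprB; apply: idealN.
  by have := phi_epath d2 (size (e1 :: s1) - i)%N; rewrite coefB coef_map.
- by rewrite rmorph0; apply: ideal_zero.
- by move=> g h _ gI _ hI; rewrite rmorphD; apply: ideal_add.
- by move=> a g _ gI; rewrite rmorphM; apply: ideal_mull.
by move=> a g _ gI; rewrite rmorphM; apply: ideal_mulr.
Qed.

Lemma phi_theta (g : T) : inI (phi (theta g) - g).
Proof.
apply: (@ideal_morph_ext _ _ _ _ _ (phi \o theta) idfun) => x /=.
rewrite -vcoef_letter theta_vcoef.
have := phi_epath (descent_to_botP bot_le (lvertex x)) (lindex x).
have := rempoly_ideal (bot_le (lvertex x)) (lindex x).
have -> : rempoly (lvertex x) bot = vpoly (lvertex x) - quopoly (lvertex x) bot.
  rewrite /rempoly [vpoly bot](_ : _ = 1) ?mulr1 //.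
  apply/polyP => i; rewrite coef_vpoly coef1; case: i => [|i]; first exact: vcoef0.
  by rewrite vcoef_big // rank_bot.
rewrite !coefB coef_map coef_vpoly /= => h1 h2.
rewrite -(subrKA (quopoly (lvertex x) bot)`_(lindex x)); apply: ideal_add => //.
by rewrite -opprB; apply: idealN.
Qed.

(** Applying [phi] to [theta g], which lies in the ideal of the splitting
    algebra, recovers [g] modulo the relations between letters; normal forms
    vanish on these. *)
Lemma psi_eq0 (g : T) : psi g = 0 -> normal_form g = 0.
Proof.
move=> /phi_ideal phiI; apply: normal_form_ideal0.
rewrite -[g](subrK (phi (theta g))); apply: ideal_add => //.
by rewrite -opprB; apply: idealN; apply: phi_theta.
Qed.

Lemma psi_normal_form (g : T) : psi (normal_form g) = psi g.
Proof.
have /psi_ideal := nf_ideal (@reduct_weight F d P T) g.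
by rewrite rmorphB => /eqP; rewrite subr_eq0 => /eqP.
Qed.

(** * Degrees *)

Definition ldeg (u : seq (letter P)) : nat := sumn (map (@lindex d P) u).
Local Notation homog n := (supp_in (fun u : seq (letter P) => ldeg u = n)).
Local Notation edge_homog n := (supp_in (fun u : seq E => size u = n)).

Lemma ldeg_cat u u' : ldeg (u ++ u') = (ldeg u + ldeg u')%N.
Proof. by rewrite /ldeg map_cat sumn_cat. Qed.

Lemma homogM m n (g h : T) : homog m g -> homog n h -> homog (m + n)%N (g * h).
Proof. by apply: supp_inM => u v <- <-; rewrite ldeg_cat. Qed.

Lemma edge_homogM m n (g h : U) :
  edge_homog m g -> edge_homog n h -> edge_homog (m + n)%N (g * h).
Proof. by apply: supp_inM => u v <- <-; rewrite size_cat. Qed.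

Lemma vcoef_homog v k : homog k (vcoef T v k).
Proof.
rewrite /vcoef; case: insubP => [x _ xE|_].
  by apply: supp_in_wd; rewrite /ldeg /= addn0 /lindex xE.
case: eqP => [->|_]; last exact: supp_in0.
by rewrite -wd_nil; apply: supp_in_wd.
Qed.

Lemma rempoly_homog v w i : homog i (rempoly v w)`_i.
Proof.
have rquot_homog j : homog j (rquot (vpoly v) (vpoly w) j).
  elim/ltn_ind: j => j IHj; rewrite rquotE !coef_vpoly.
  apply: supp_inB; first exact: vcoef_homog.
  apply: supp_in_sum => t _; rewrite coef_vpoly.
  have := homogM (IHj _ (ltn_ord t)) (@vcoef_homog w (j - t)%N).
  by rewrite subnKC // ltnW.
rewrite coefB coef_vpoly coefM; apply: supp_inB; first exact: vcoef_homog.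
apply: supp_in_sum => t _; rewrite coef_vpoly coef_poly.
case: ifP => _; last by rewrite mul0r; apply: supp_in0.
have := homogM (@rquot_homog t) (@vcoef_homog w (i - t)%N).
by rewrite subnKC // -ltnS.
Qed.

Lemma normal_form_homog n (g : T) : homog n g -> homog n (normal_form g).
Proof.
apply: nf_supp; first exact: reduct_weight.
move=> u x y v xy <-.
have rxy : homog (lindex x + lindex y)%N (reduct T x y).
  apply: supp_inD; last exact: rempoly_homog.
  by apply: supp_in_wd; rewrite /ldeg /= addn0.
have hu : homog (ldeg u) (wd T u) by apply: supp_in_wd.
have hv : homog (ldeg v) (wd T v) by apply: supp_in_wd.
by have := homogM (homogM hu rxy) hv; rewrite ldeg_cat /ldeg /= !addnA.
Qed.

Lemma phi_homog n (g : U) : edge_homog n g -> homog n (phi g).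
Proof.
move: g; apply: supp_in_ind.
- by rewrite rmorph0; apply: supp_in0.
- by move=> a g h ? ?; rewrite linearP /=; apply: supp_inD => //; apply: supp_inZ.
move=> u <-; elim: u => [|e u IHu].
  by rewrite wd_nil rmorph1 -wd_nil; apply: supp_in_wd.
rewrite -cat1s -wdM rmorphM; apply: (@homogM 1) => //.
by rewrite /= phi_edge; apply: supp_inB; exact: vcoef_homog.
Qed.

Lemma epath_homog s i : edge_homog i (epath s)`_i.
Proof.
rewrite /epath; elim: s i => [|e s IHs] i.
  rewrite /rpath big_nil coef1; case: eqP => [->|_]; last exact: supp_in0.
  by rewrite -wd_nil; apply: supp_in_wd.
rewrite rpath_cons; apply: supp_inB => //; case: i => [|i]; first exact: supp_in0.
by apply: (@edge_homogM 1) => //; apply: supp_in_wd.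
Qed.

Lemma theta_homog n (g : T) : homog n g -> edge_homog n (theta g).
Proof.
move: g; apply: supp_in_ind.
- by rewrite rmorph0; apply: supp_in0.
- by move=> a g h ? ?; rewrite linearP /=; apply: supp_inD => //; apply: supp_inZ.
move=> u <-; elim: u => [|x u IHu].
  by rewrite wd_nil rmorph1 -wd_nil; apply: supp_in_wd.
rewrite -cat1s -wdM rmorphM ldeg_cat; apply: edge_homogM => //.
by rewrite /= theta_letter /ldeg /= addn0; exact: epath_homog.
Qed.

(** * Automorphisms and the basis of normal words *)

Variable sigma : poset_aut P.
Variable sigmaA : {lrmorphism A -> A}.
Hypothesis sigmaA_edge : forall e, sigmaA (pi (edge e)) = pi (edge (edge_aut sigma e)).

Lemma letter_aut_subproof x : is_letter (sigma (lvertex x), lindex x).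
Proof. by rewrite /is_letter /= (aut_rank bot_le); apply: (valP x). Qed.

Definition letter_aut x : letter P := Sub (_, _) (letter_aut_subproof x).

Lemma sigmaA_epath s i :
  sigmaA (pi (epath s)`_i) = pi (epath (map (edge_aut sigma) s))`_i.
Proof.
rewrite /epath; elim: s i => [|e s IHs] i.
  by rewrite /rpath !big_nil coef1; case: (_ == _); rewrite ?rmorph1 ?rmorph0.
rewrite /= !rpath_cons !rmorphB /= IHs; congr (_ - _).
by case: i => [|i]; rewrite ?rmorph0 // !rmorphM /= sigmaA_edge IHs.
Qed.

(** The automorphism moves the chosen path of a vertex to a path of the image
    of the vertex, which has the same polynomial as the chosen one. *)
Lemma sigmaA_psi u : sigmaA (psi (wd T u)) = psi (wd T (map letter_aut u)).
Proof.
elim: u => [|x u IHu]; first by rewrite /= wd_nil !rmorph1.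
rewrite -cat1s map_cat -!wdM !rmorphM [X in _ * X]IHu; congr (_ * _).
rewrite /= -!vcoef_letter /psi /= !theta_vcoef sigmaA_epath.
apply: (epath_equiv (v := sigma (lvertex x)) (w := bot)).
  by rewrite -{2}(aut_bot bot_le sigma) descent_aut; apply: descent_to_botP.
exact: descent_to_botP.
Qed.

Lemma reducible_aut x y : reducible (letter_aut x) (letter_aut y) = reducible x y.
Proof.
rewrite /reducible /letter_aut /lvertex /lindex !SubK /= !(aut_rank bot_le).
by rewrite !lt_neqAle poset_autP (inj_eq perm_inj).
Qed.

Lemma normal_aut u : normal_word (@reducible d P) (map letter_aut u) =
  normal_word (@reducible d P) u.
Proof.
rewrite /normal_word sorted_map; apply: eq_sorted => x y /=.
by rewrite reducible_aut.
Qed.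

Lemma ldeg_aut u : ldeg (map letter_aut u) = ldeg u.
Proof. by rewrite /ldeg -map_comp. Qed.

(** The normal words of degree [n] are independent by [psi_eq0] and span the
    piece of degree [n] by [psi_phi].  As the automorphism permutes this basis,
    its trace counts the fixed basis elements. *)
Lemma trace_on_piece n (W : seq (seq (letter P))) :
  uniq W ->
  (forall u, (u \in W) = normal_word (@reducible d P) u && (ldeg u == n)) ->
  has_trace_on (fun z => exists2 g, edge_homog n g & z = pi g) sigmaA
    (count (fun u => map letter_aut u == u) W)%:R.
Proof.
move=> W_uniq memW; pose word i := nth [::] W i.
pose b (i : 'I_(size W)) := psi (wd T (word i)).
pose comb (a : 'rV[F]_(size W)) : T := \sum_(j < size W) a 0 j *: wd T (word j).
have combE a : lin_comb b a = psi (comb a).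
  by rewrite linear_sum; apply: eq_bigr => j _; rewrite linearZ.
have word_mem (i : 'I_(size W)) : word i \in W by apply: mem_nth.
have word_inj (i j : 'I_(size W)) : (word i == word j) = (i == j).
  by rewrite nth_uniq.
have comb_coef a (i : 'I_(size W)) : coefw (word i) (comb a) = a 0 i.
  rewrite coefw_sum (bigD1 i) //= big1 ?addr0 // => j /andP[].
  by rewrite word_inj => /eqP ->; rewrite eqxx.
have index_word u : u \in W -> exists i : 'I_(size W), word i = u.
  by move=> uW; exists (Ordinal (etrans (index_mem u W) uW)); apply: nth_index.
exists (size W), b.
exists (\matrix_(i, j) (map letter_aut (word i) == word j)%:R); split.
- split.
  + move=> i; exists (theta (wd T (word i))) => //.
    apply: theta_homog; apply: supp_in_wd.
    by have := word_mem i; rewrite memW => /andP[_ /eqP].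
  + move=> a; rewrite combE => /psi_eq0; rewrite /normal_form nf_id.
    - move=> a0; apply/rowP => i; rewrite mxE -comb_coef a0.
      by rewrite linear0.
    - exact: reduct_weight.
    apply: supp_in_sum => j _; apply: supp_inZ; apply: supp_in_wd.
    by have := word_mem j; rewrite memW => /andP[].
  + move=> z [g gn ->]; pose h := normal_form (phi g).
    exists (\row_j coefw (word j) h); rewrite combE -psi_phi -psi_normal_form.
    congr (psi _); apply: coefwP => u.
    have [uW|uW] := boolP (u \in W).
      by have [i <-] := index_word u uW; rewrite comb_coef mxE.
    rewrite [RHS]coefw_sum big_pred0; last first.
      by move=> j; apply: contraNF uW => /eqP <-; apply: word_mem.
    apply/eqP; apply: contraNT uW => hu; rewrite memW.
    rewrite (nf_normal (@reduct_weight F d P T) hu) /=.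
    by apply/eqP; move: hu; apply: normal_form_homog; apply: phi_homog.
- move=> i; rewrite /b sigmaA_psi.
  have [j jE] : exists j : 'I_(size W), word j = map letter_aut (word i).
    apply: index_word; rewrite memW normal_aut ldeg_aut -memW; exact: word_mem.
  rewrite /lin_comb (bigD1 j) //= !mxE -jE eqxx scale1r big1 ?addr0 // => t tj.
  by rewrite !mxE -jE word_inj eq_sym (negPf tj) scale0r.
rewrite -sum1_count natr_sum [RHS]big_mkcond [RHS](big_nth [::]) big_mkord.
by apply: eq_bigr => i _; rewrite mxE; case: eqP.
Qed.

End Presentation.

(** * Enumeration of words *)

Section Words.
Variables (d : Order.disp_t) (P : finRankedPOrderType d).
Implicit Types (x : letter P) (u : seq (letter P)).

Definition letters : seq (letter P) :=
  pmap insub [seq (v, k) | v <- enum P, k <- iota 1 (rank v)].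

Lemma letters_uniq : uniq letters.
Proof.
rewrite pmap_sub_uniq //; apply: allpairs_uniq_dep.
- exact: enum_uniq.
- by move=> v _; exact: iota_uniq.
- by move=> [v k] [v' k'] _ _ [-> ->].
Qed.

Lemma mem_letters x : x \in letters.
Proof.
rewrite mem_pmap_sub; apply/allpairsPdep; exists (lvertex x), (lindex x).
split; rewrite ?mem_enum //; last by rewrite -surjective_pairing.
by rewrite mem_iota add1n ltnS lindex_gt0 lindex_le.
Qed.

(** Letters have positive degree, so [m] need not exceed the degree [n]. *)
Fixpoint words_fuel (m n : nat) : seq (seq (letter P)) :=
  if n is 0 then [:: [::]] else
  if m is m'.+1 then
    [seq x :: u | x <- [seq x <- letters | (lindex x <= n)%N],
                  u <- words_fuel m' (n - lindex x)]
  else [::].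

Lemma mem_words_fuel m n u : (n <= m)%N -> (u \in words_fuel m n) = (ldeg u == n).
Proof.
elim: m n u => [|m IHm] [|n] u //= nm.
- case: u => [|x u] //; rewrite inE /ldeg /=; have := lindex_gt0 x.
  by case: (lindex x).
- case: u => [|x u] //; rewrite inE /ldeg /=; have := lindex_gt0 x.
  by case: (lindex x).
apply/allpairsPdep/eqP => [[x [u' [xn u'W ->]]]|un].
  move: xn; rewrite mem_filter => /andP[xn _].
  move: u'W; rewrite IHm; last by have := lindex_gt0 x; lia.
  by move=> /eqP; rewrite /ldeg /=; lia.
case: u un => [//|x u] un; exists x, u; split=> //.
  by rewrite mem_filter mem_letters andbT -un /ldeg /= leq_addr.
have ux : ldeg u = (n.+1 - lindex x)%N by move: un; rewrite /ldeg /=; lia.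
by rewrite IHm ?ux //; have := lindex_gt0 x; lia.
Qed.

Lemma words_fuel_uniq m n : uniq (words_fuel m n).
Proof.
elim: m n => [|m IHm] [|n] //=; apply: allpairs_uniq_dep => //.
- exact/filter_uniq/letters_uniq.
- by move=> [x u] [x' u'] _ _ [-> ->].
Qed.

Definition words n := words_fuel n n.

Lemma mem_words n u : (u \in words n) = (ldeg u == n).
Proof. exact: mem_words_fuel. Qed.

Lemma words_uniq n : uniq (words n).
Proof. exact: words_fuel_uniq. Qed.

Lemma count_words (p : pred (seq (letter P))) n : (0 < n)%N ->
  count p (words n) = (\sum_(x <- letters | (lindex x <= n)%N)
     count (fun u => p (x :: u)) (words (n - lindex x)))%N.
Proof.
case: n => // n _; rewrite [words _]/= count_flatten sumnE !big_map big_filter.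
apply: eq_bigr => x xn; rewrite count_map.
have lx := lindex_gt0 x.
suff /seq.permP E : perm_eq (words_fuel n (n.+1 - lindex x)) (words (n.+1 - lindex x)).
  exact: E.
apply: uniq_perm; [exact: words_fuel_uniq|exact: words_fuel_uniq|move=> u].
by rewrite mem_words mem_words_fuel //; lia.
Qed.

End Words.

(** * The graded trace as a count of words *)

Section SplittingTrace.
Variables (F : fieldType) (d : Order.disp_t) (P : finRankedPOrderType d).

Definition edge_freeAlg : freeAlg F (hasse_edge P) :=
  @FreeAlg F (hasse_edge P) (free_alg F P)
    (fun u => << FMonom u >>) (fun u (g : free_alg F P) => g@_(FMonom u))
    (fun g : free_alg F P => [seq val w | w <- enum_fset (msupp g)])
    (@malg_coef_linear F _) (@malg_coef_word F _) (@malg_wordM F _)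
    (@malg_word_nil F _) (@malg_supp_uniq F _) (@malg_suppE F _).


Lemma edge_freeAlg_gen e : wd edge_freeAlg [:: e] = free_gen F e.
Proof.
rewrite /free_gen /=; congr << 1 *g _ >>; apply: val_inj.
by rewrite /= fmU.
Qed.

Lemma splitting_pi_kernel (g : edge_freeAlg) :
  splitting_pi (g : free_alg F P) = 0 <->
  two_sided_ideal (@path_relator F d P edge_freeAlg) g.
Proof.
have relE : @path_relator F d P edge_freeAlg = @splitting_relator F d P.
  apply/funext => h; rewrite /path_relator /splitting_relator.
  have pathE s : ppath (fun e => wd edge_freeAlg [:: e]) s = path_poly F s.
    rewrite /ppath /path_poly; apply: eq_bigr => e _.
    by rewrite edge_freeAlg_gen.
  apply/propext; split=> -[e1 [s1 [e2 [s2 [i [h1 h2 h3 h4]]]]]].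
    exists e1, s1, e2, s2, i; split; [exact: h1|exact: h2|exact: h3|].
    by rewrite -!pathE; exact h4.
  exists e1, s1, e2, s2, i; split; [exact: h1|exact: h2|exact: h3|].
  by rewrite !pathE; exact h4.
rewrite relE; split.
  move=> g0; apply/splitting_idealP; rewrite -[g]subr0.
  by apply/splitting_piP; rewrite g0 raddf0.
move=> /splitting_idealP gI; rewrite -(raddf0 (@splitting_pi F d P)).
by apply/splitting_piP; rewrite subr0.
Qed.

Variables (bot : P) (bot_le : forall v, (bot <= v)%O) (sigma : poset_aut P).

Lemma trace_words n :
  has_trace_on (splitting_piece F P n) (splitting_aut sigma)
    (count (fun u => normal_word (@reducible d P) u &&
                     all (fun x => letter_aut bot_le sigma x == x) u) (words P n))%:R.
Proof.
pose T := malg_freeAlg F (letter P).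
have pieceE : splitting_piece F P n =
    (fun z => exists2 g : edge_freeAlg,
      supp_in (fun u : seq (hasse_edge P) => size u = n) g & z = splitting_pi g).
  apply/funext => z; apply/propext; split=> -[g gn zE]; exists g.
  - by move=> u gu; exact: (gn (FMonom u) gu).
  - exact: zE.
  - by move=> [u] gu; exact: (gn u gu).
  exact: zE.
rewrite pieceE.
have aut_edge e : splitting_aut sigma (splitting_pi (wd edge_freeAlg [:: e])) =
    splitting_pi (wd edge_freeAlg [:: edge_aut sigma e]) :> splitting_alg F P.
  rewrite !edge_freeAlg_gen; exact: splitting_aut_gen.
have := @trace_on_piece F d P edge_freeAlg (splitting_alg F P)
  (@splitting_pi F d P) splitting_pi_kernel bot bot_le T sigma
  (splitting_aut sigma) aut_edge n
  (filter (normal_word (@reducible d P)) (words P n)).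
rewrite count_filter => trace.
have -> : count (fun u => normal_word (@reducible d P) u &&
      all (fun x => letter_aut bot_le sigma x == x) u) (words P n) =
    count (predI (fun u => map (letter_aut bot_le sigma) u == u)
                 (normal_word (@reducible d P))) (words P n).
  apply: eq_count => u /=; rewrite andbC; congr (_ && _).
  by elim: u => //= x u ->; rewrite eqseq_cons.
apply: trace; first by apply: filter_uniq; apply: words_uniq.
by move=> u; rewrite mem_filter mem_words.
Qed.

End SplittingTrace.

(** * Counting fixed normal words *)

Section Counting.
Variables (d : Order.disp_t) (P : finRankedPOrderType d).
Variables (bot : P) (bot_le : forall v, (bot <= v)%O) (sigma : poset_aut P).
Implicit Types (v w : P) (x y : letter P) (u : seq (letter P)).

Definition fixed_normal u : bool :=
  normal_word (@reducible d P) u && all (fun x => letter_aut bot_le sigma x == x) u.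

Definition starts_at v u : bool := if u is x :: _ then lvertex x == v else false.

Definition nfixed n : nat := count fixed_normal (words P n).

Definition nfixed_at v n : nat :=
  count (fun u => fixed_normal u && starts_at v u) (words P n).

Lemma letter_aut_fixed x :
  (letter_aut bot_le sigma x == x) = (sigma (lvertex x) == lvertex x).
Proof.
rewrite -val_eqE /letter_aut SubK [val x]surjective_pairing.
by rewrite xpair_eqE eqxx andbT.
Qed.

Lemma fixed_normal_cons x u : fixed_normal (x :: u) =
  [&& sigma (lvertex x) == lvertex x, fixed_normal u
    & if u is y :: _ then ~~ reducible x y else true].
Proof.
rewrite /fixed_normal /= letter_aut_fixed /normal_word.
case: u => [|y u] /=; first by rewrite andbT.
by case: (sigma _ == _); case: (reducible x y); rewrite ?andbF ?andbT.
Qed.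

Lemma big_letters (f : P * nat -> nat) (p : pred (P * nat)) :
  (\sum_(x <- letters P | p (val x)) f (val x) =
   \sum_v \sum_(1 <= k < (rank v).+1 | p (v, k)) f (v, k))%N.
Proof.
rewrite -(big_map val p f) /letters pmap_filter; last exact: insubK.
rewrite (eq_filter (isSome_insub _)) (all_filterP _); last first.
  apply/allP => _ /allpairsPdep [v [k [_ kv ->]]].
  by move: kv; rewrite mem_iota add1n ltnS.
rewrite big_mkcond big_allpairs_dep big_enum; apply: eq_bigr => v _.
by rewrite -big_mkcond /index_iota subSS subn0.
Qed.

Lemma count_starts (p : pred (seq (letter P))) (q : pred P) (s : seq (seq (letter P))) :
  count (fun u => p u && (if u is y :: _ then q (lvertex y) else false)) s =
  (\sum_(w | q w) count (fun u => p u && starts_at w u) s)%N.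
Proof.
elim: s => [|u s IHs] /=; first by rewrite big1.
rewrite IHs big_split /=; congr (_ + _)%N.
case: u => [|y u] /=; first by rewrite andbF big1 // => w _; rewrite andbF.
case: (p _) => /=; last by rewrite big1.
have [qy|qy] := boolP (q (lvertex y)).
  rewrite (bigD1 (lvertex y)) //= eqxx big1 // => w /andP[_ /negPf].
  by rewrite eq_sym => ->.
by rewrite big1 // => w qw; case: eqP => // wy; rewrite wy qw in qy.
Qed.

Lemma nfixed_sum n : (0 < n)%N -> nfixed n = (\sum_v nfixed_at v n)%N.
Proof.
move=> n0; rewrite /nfixed_at -count_starts /nfixed; apply: eq_in_count => u.
rewrite mem_words; case: u => [/eqP n_eq|x u _]; last by rewrite /= andbT.
by rewrite -n_eq in n0.
Qed.

(** Prefixing the letter [(v, k)] to a normal word gives a normal word unless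
    the first vertex [w] of the word lies [k] steps below [v]. *)
Lemma nfixed_at_rec v n : sigma v = v ->
  (nfixed_at v n +
   \sum_(w | (w < v)%O && (rank v - rank w <= n)) nfixed_at w (n - (rank v - rank w)) =
   \sum_(1 <= k < (rank v).+1 | k <= n) nfixed (n - k))%N.
Proof.
move=> vfix.
pose after k m := count (fun u => fixed_normal u &&
  (if u is y :: _ then ~~ ((lvertex y < v)%O && (k + rank (lvertex y) == rank v)%N)
   else true)) (words P m).
have afterE k m : (nfixed m = after k m +
    \sum_(w | (w < v)%O && (k + rank w == rank v)) nfixed_at w m)%N.
  rewrite /nfixed_at -(count_starts _
    (fun w => (w < v)%O && (k + rank w == rank v)%N)) /after /nfixed.
  rewrite -count_predUI [X in (_ + X)%N](_ : _ = 0%N); last first.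
    apply/eqP; rewrite -leqn0 leqNgt -has_count; apply/hasPn => u _ /=.
    case: u => [|y u] //=; case: (fixed_normal (y :: u)) => //=.
    by case: (_ < _)%O; case: (_ == _).
  rewrite addn0; apply: eq_count => u /=; case: u => [|y u] //=.
  by case: (fixed_normal (y :: u)) => //=; case: (_ < _)%O; case: (_ == _).
have nfixed_atE : nfixed_at v n = (\sum_(1 <= k < (rank v).+1 | k <= n) after k (n - k))%N.
  have [->|n0] := posnP n.
    rewrite big_nat_cond big1; first by rewrite /nfixed_at /=.
    by move=> k /andP[/andP[k0 _]]; rewrite leqNgt k0.
  rewrite /nfixed_at count_words //.
  pose f (vk : P * nat) := (if vk.1 == v then after vk.2 (n - vk.2) else 0)%N.
  transitivity (\sum_(x <- letters P | (val x).2 <= n) f (val x))%N.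
    apply: eq_bigr => x _; rewrite /f -/(lvertex x) -/(lindex x) /=.
    case: eqP => [xv|_]; last first.
      by rewrite -(count_pred0 (words P (n - lindex x))); apply: eq_count => u; rewrite andbF.
    apply: eq_count => u; rewrite fixed_normal_cons andbT xv vfix eqxx /=.
    by congr (_ && _); case: u => // y u; rewrite /reducible xv.
  rewrite (big_letters f (fun vk => vk.2 <= n)%N) (bigD1 v) //= [X in (_ + X)%N]big1 ?addn0.
    by apply: eq_bigr => k _; rewrite /f eqxx.
  by move=> w /negPf wv; rewrite big1 // => k _; rewrite /f wv.
rewrite nfixed_atE (eq_bigr _ (fun k _ => afterE k (n - k)%N)) big_split /=.
congr (_ + _)%N; rewrite (exchange_big_dep (fun w => (w < v)%O && (rank v - rank w <= n)%N)) /=.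
  apply: eq_bigr => w /andP[wv wn]; have := rank_lt wv => rwv.
  rewrite (big_rem (rank v - rank w)%N) /=; last first.
    by rewrite mem_index_iota subn_gt0 rwv ltnS leq_subr.
  rewrite wn wv subnK ?(ltnW rwv) // eqxx /= big_seq_cond big1 ?addn0 //.
  move=> k; rewrite mem_rem_uniq ?iota_uniq // inE => /andP[/andP[kw _]].
  by case/andP=> _ /eqP kE; rewrite -kE addnK eqxx in kw.
by move=> k w kn /andP[-> /eqP <-]; rewrite addnK.
Qed.

Lemma nfixed_at_unfixed v n : sigma v != v -> nfixed_at v n = 0%N.
Proof.
move=> vfix; rewrite /nfixed_at -(count_pred0 (words P n)); apply: eq_count.
move=> [|x u]; rewrite /= ?andbF // fixed_normal_cons.
by case: eqP => [|_] //=; case: eqP => [->|]; rewrite ?andbF // => /eqP; rewrite (negPf vfix).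
Qed.

Lemma nfixed_at0 v : nfixed_at v 0 = 0%N.
Proof. by rewrite /nfixed_at /=. Qed.

Lemma nfixed0 : nfixed 0 = 1%N.
Proof. by []. Qed.

End Counting.

(** * The generating function *)

(** Power series are represented by their truncations. *)
Definition eqmod (R : nzRingType) (K : nat) (p q : {poly R}) : Prop :=
  forall i, (i < K)%N -> p`_i = q`_i.

Section GeneratingFunction.
Variables (F : fieldType) (d : Order.disp_t) (P : finRankedPOrderType d).
Variables (bot : P) (bot_le : forall v, (bot <= v)%O) (sigma : poset_aut P).
Implicit Types (v w : P) (p q r : {poly F}).

Lemma eqmodM K p q r : eqmod K q r -> eqmod K (p * q) (p * r).
Proof.
move=> qr i iK; rewrite !coefM; apply: eq_bigr => j _; rewrite qr //.
by apply: leq_ltn_trans iK; apply: leq_subr.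
Qed.

Lemma eqmod_sum K (I : Type) (s : seq I) (a : pred I) (f g : I -> {poly F}) :
  (forall i, a i -> eqmod K (f i) (g i)) ->
  eqmod K (\sum_(i <- s | a i) f i) (\sum_(i <- s | a i) g i).
Proof.
by move=> fg i iK; rewrite !coef_sum; apply: eq_bigr => j /fg; apply.
Qed.

Local Notation nfixed := (nfixed bot_le sigma).
Local Notation nfixed_at := (nfixed_at bot_le sigma).

Definition total K : {poly F} := \poly_(n < K) (nfixed n)%:R.
Definition total_at K v : {poly F} := \poly_(n < K) (nfixed_at v n)%:R.

Lemma total_sum K : (0 < K)%N -> \sum_v total_at K v = total K - 1.
Proof.
move=> K0; apply/polyP => i; rewrite coef_sum coefB coef1 coef_poly.
rewrite (eq_bigr (fun v => if (i < K)%N then (nfixed_at v i)%:R else 0 : F)); last first.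
  by move=> v _; rewrite coef_poly.
case: ltnP => [iK|Ki]; last first.
  by rewrite big1 // sub0r gtn_eqF ?oppr0 // (leq_trans K0).
case: i iK => [|i] iK.
  by rewrite big1 ?nfixed0 ?subrr // => v _; rewrite nfixed_at0.
by rewrite (nfixed_sum bot_le sigma (ltn0Sn i)) natr_sum subr0.
Qed.

Lemma total_at_rec K v : sigma v = v ->
  eqmod K (\sum_(w | (w <= v)%O) 'X^(rank v - rank w) * total_at K w)
          ((\sum_(1 <= k < (rank v).+1) 'X^k) * total K).
Proof.
move=> vfix i iK; rewrite coef_sum (bigD1 v) //= subnn mul1r coef_poly iK.
rewrite mulr_suml coef_sum.
rewrite (eq_bigr (fun k => if (k <= i)%N then (nfixed (i - k))%:R else 0 : F)); last first.
  move=> k _; rewrite coefXnM coef_poly (leq_ltn_trans (leq_subr k i) iK).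
  by case: ltnP.
rewrite -big_mkcond -natr_sum -(nfixed_at_rec bot_le) // natrD; congr (_ + _).
rewrite natr_sum [RHS]big_mkcondr; apply: eq_big => [w|w wv].
  by rewrite lt_neqAle andbC.
rewrite coefXnM coef_poly (leq_ltn_trans (leq_subr _ i) iK).
by case: ltnP.
Qed.

Lemma geometric n :
  (1 - 'X) * (\sum_(1 <= k < n.+1) 'X^k) = 'X - 'X^(n.+1) :> {poly F}.
Proof.
elim: n => [|n IHn]; first by rewrite big_geq // mulr0 expr1 subrr.
rewrite big_nat_recr //= mulrDr IHn mulrBl mul1r -exprS.
by rewrite addrA subrK.
Qed.

(** On the fixed subposet, let a pair [w <= v] have as zeta value ['X] to the
    power of the difference of ranks.  Then [y v] is the sum over [u] of the
    values at [(v, u)] of the inverse, a weighted Moebius function. *)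
Variable y : P -> {poly F}.
Hypothesis yP : forall w, sigma w = w ->
  \sum_(v | (sigma v == v) && (w <= v)%O) y v * 'X^(rank v - rank w) = 1.
Local Notation M := (\sum_(v | sigma v == v) y v).

(** Summing [total_at_rec] over the fixed [v] with weights [y v], the left sides
    add up to the series of all nonempty words.  On the right, after
    multiplication by [1 - 'X], the geometric sums leave ['X - 'X^(rank v).+1],
    whose second part adds up to ['X] by [yP] at the bottom. *)
Lemma total_eq K : (0 < K)%N -> eqmod K (total K * (1 - 'X * M)) (1 - 'X).
Proof.
move=> K0.
have E : eqmod K (\sum_(v | sigma v == v) (y v * (1 - 'X)) *
    \sum_(w | (w <= v)%O) 'X^(rank v - rank w) * total_at K w)
  (\sum_(v | sigma v == v) (y v * (1 - 'X)) *
    ((\sum_(1 <= k < (rank v).+1) 'X^k) * total K)).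
  by apply: eqmod_sum => v /eqP vfix; apply: eqmodM; apply: total_at_rec.
move: E; set lhs := \sum_(v | _) _ * \sum_(w | _) _; set rhs := \sum_(v | _) _ * (_ * _).
have -> : lhs = (1 - 'X) * (total K - 1).
  rewrite -total_sum // mulr_sumr /lhs.
  under eq_bigr => v _ do rewrite mulr_sumr.
  rewrite (exchange_big_dep predT) //=; apply: eq_bigr => w _.
  have [wfix|wfix] := eqVneq (sigma w) w; last first.
    have -> : total_at K w = 0.
      apply/polyP => i; rewrite coef_poly coef0 nfixed_at_unfixed //.
      by case: ifP.
    by rewrite mulr0 big1 // => v _; rewrite !mulr0.
  rewrite -[RHS]mulr1 -(yP wfix) mulr_sumr; apply: eq_bigr => v _.
  by ring.
have -> : rhs = 'X * total K * (M - 1).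
  rewrite /rhs (eq_bigr (fun v => 'X * total K * y v - 'X * total K * (y v * 'X^(rank v - rank bot)))).
    rewrite sumrB -!mulr_sumr mulrBr; congr (_ - _ * _).
    rewrite -[RHS](yP (aut_bot bot_le sigma)).
    by apply: eq_bigl => v; rewrite bot_le andbT.
  move=> v _; rewrite (rank_bot bot_le) subn0 -mulrA [(1 - 'X) * _]mulrA geometric.
  by rewrite exprS; ring.
move=> E i iK; have := E i iK => {}E.
have -> : total K * (1 - 'X * M) =
    (1 - 'X) * (total K - 1) - 'X * total K * (M - 1) + (1 - 'X) by ring.
by rewrite coefD coefB E subrr add0r.
Qed.

Lemma series_div_unique (N D : {poly F}) (c : nat -> F) : D`_0 = 1 ->
  (forall k, \sum_(i < k.+1) c i * D`_(k - i) = N`_k) -> c =1 series_div N D.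
Proof.
move=> D0 cE; elim/ltn_ind => k IHk.
have := series_divP N (_ : D`_0 != 0); rewrite D0 oner_eq0 => /(_ isT k).
rewrite -cE !big_ord_recr /= subnn D0 !mulr1.
rewrite (eq_bigr (fun i : 'I_k => c i * D`_(k - i))) => [/addrI //|i _].
by rewrite IHk.
Qed.

Lemma nfixed_series k : (nfixed k)%:R = series_div (1 - 'X) (1 - 'X * M) k :> F.
Proof.
move: k; apply: series_div_unique; first by rewrite coefB coef1 coefXM subr0.
move=> k; rewrite -(@total_eq k.+1) // coefM; apply: eq_bigr => i _.
by rewrite coef_poly ltn_ord.
Qed.

Theorem graded_trace :
  has_graded_trace (splitting_piece F P) (splitting_aut sigma)
    (series_div (1 - 'X) (1 - 'X * M)).
Proof. by move=> k; rewrite -nfixed_series; apply: trace_words. Qed.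

End GeneratingFunction.

(** * Factors fixed by a permutation of the primes *)

Section FixedFactors.
Variables (n : nat) (n_gt0 : (0 < n)%N) (sigma : {perm prime_factor n}).
Hypothesis Hsigma : preserves_multiplicity sigma.
Implicit Types (p q : prime_factor n) (v w : factor n) (c : {set prime_factor n}).
Local Notation aut := (factor_aut Hsigma).

Definition expo v p : nat := logn (val p) (factor_val v).

Definition factor1 : factor n :=
  SeqSub (divisor1 n : (1%N : natdvd) \in (divisors n : seq natdvd)).

Lemma factor1_le v : (factor1 <= v)%O.
Proof. by rewrite factor_leE dvd1n. Qed.

Lemma expo_le v p : (expo v p <= logn (val p) n)%N.
Proof. exact: dvdn_leq_log (factor_dvd v). Qed.

Lemma factor_leP w v : reflect (forall p, expo w p <= expo v p)%N (w <= v)%O.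
Proof.
rewrite factor_leE; apply: (iffP idP) => [wv p|le].
  by apply: dvdn_leq_log wv; apply: factor_gt0.
apply: dvdn_logn; rewrite ?factor_gt0 // => q _.
have [qn|/logn_factor_out -> //] := boolP (q \in primes n).
exact: le (SeqSub qn).
Qed.

Lemma expo_inj v w : (forall p, expo v p = expo w p) -> v = w.
Proof.
by move=> vw; apply/le_anti/andP; split; apply/factor_leP => p; rewrite vw.
Qed.

Lemma logn_prod (f : prime_factor n -> nat) q :
  logn (val q) (\prod_p val p ^ f p) = f q.
Proof.
have q_prime := prime_factor_prime q.
suff [_ ->] : (0 < \prod_p val p ^ f p)%N /\
    logn (val q) (\prod_p val p ^ f p) = (\sum_p (q == p) * f p)%N.
  by rewrite (bigD1 q) //= eqxx mul1n big1 ?addn0 // => p /negPf; rewrite eq_sym => ->.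
apply: (big_ind2 (fun a b => (0 < a)%N /\ logn (val q) a = b)).
- by rewrite logn1.
- by move=> a b a' b' [a0 <-] [a'0 <-]; rewrite muln_gt0 a0 a'0 lognM.
move=> p _; have p_prime := prime_factor_prime p.
rewrite expn_gt0 prime_gt0 //; split=> //.
by rewrite lognX [logn _ _]logn_prime // mulnC.
Qed.

Lemma prod_dvd (f : prime_factor n -> nat) :
  (forall p, f p <= logn (val p) n)%N -> (\prod_p val p ^ f p)%N \in divisors n.
Proof.
move=> le; have gt0 : (0 < \prod_p val p ^ f p)%N.
  by rewrite prodn_gt0 // => p; rewrite expn_gt0 prime_gt0 ?prime_factor_prime.
rewrite -dvdn_divisors //; apply: dvdn_logn => // q q_prime.
have [qn|qn] := boolP (q \in primes n).
  by rewrite (logn_prod f (SeqSub qn)) le.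
rewrite (_ : logn q _ = 0)%N //; apply/eqP; rewrite -leqn0 leqNgt logn_gt0.
rewrite mem_primes q_prime gt0 /=.
apply: (big_ind (fun a => ~~ (q %| a)%N)) => [|a b qa qb|p _].
- by rewrite dvdn1; case: eqP q_prime => // ->.
- by rewrite Euclid_dvdM // negb_or qa.
rewrite Euclid_dvdX // dvdn_prime2 ?prime_factor_prime // negb_and.
by apply/orP; left; apply: contra qn => /eqP ->; apply: ssvalP.
Qed.

Lemma expo_aut v p : expo (aut v) (sigma p) = expo v p.
Proof. by rewrite /expo factor_autE logn_factor_act_in. Qed.

Lemma fixedP v : reflect (forall p, expo v (sigma p) = expo v p) (aut v == v).
Proof.
apply: (iffP eqP) => [vE p|vE]; first by rewrite -{1}vE expo_aut.
apply: expo_inj => p; rewrite -(permKV sigma p) expo_aut.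
by rewrite vE.
Qed.

Lemma expo_orbit v p q : aut v = v -> q \in porbit sigma p -> expo v q = expo v p.
Proof.
move=> /eqP/fixedP vE /porbitP [i ->].
by elim: i => [|i IHi]; rewrite ?expg0 ?perm1 // expgSr permM vE.
Qed.

(** When [v] is fixed, this is the exponent in [v] of every prime of [c]. *)
Definition oexpo v c : nat := if [pick p in c] is Some p then expo v p else 0%N.

Lemma oexpoE v p : aut v = v -> oexpo v (porbit sigma p) = expo v p.
Proof.
move=> vfix; rewrite /oexpo; case: pickP => [q qp|/(_ p)].
  exact: expo_orbit.
by rewrite porbit_id.
Qed.

Lemma rankE v : rank v = (\sum_p expo v p)%N.
Proof.
rewrite [rank v](@Omega_widen n.+1 (factor_val v)); last first.
  by rewrite ltnS; apply: dvdn_leq => //; apply: factor_dvd.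
rewrite (bigID (mem (primes n))) /= [X in (_ + X)%N]big1 ?addn0; last first.
  by move=> q; apply: logn_factor_out.
rewrite -big_filter; apply/esym.
rewrite -(big_map (fun p : prime_factor n => val p : nat) xpredT
   (fun r => logn r (factor_val v))).
apply: perm_big; apply: uniq_perm.
- by rewrite map_inj_uniq ?index_enum_uniq //; apply: val_inj.
- by rewrite filter_uniq // iota_uniq.
move=> q; rewrite mem_filter mem_index_iota /=; apply/mapP/andP => [[p _ ->]|[qn _]].
  have pn : val p \in primes n by apply: ssvalP.
  split=> //; rewrite ltnS dvdn_leq //.
  by move: pn; rewrite mem_primes => /and3P[].
by exists (SeqSub qn); rewrite ?mem_index_enum.
Qed.

Lemma rank_fixed v : aut v = v ->
  rank v = (\sum_(c in porbits sigma) #|c| * oexpo v c)%N.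
Proof.
move=> vfix; rewrite rankE (partition_big_imset (porbit sigma)) /=.
apply: eq_bigr => _ /imsetP [p _ ->].
rewrite oexpoE // -sum_nat_const; apply: eq_big => q.
  by rewrite eq_porbit_mem.
by move=> /eqP qp; apply: expo_orbit; rewrite // -eq_porbit_mem qp.
Qed.

Variable m : {set prime_factor n} -> nat.
Hypothesis Hm : forall c p, c \in porbits sigma -> p \in c -> logn (val p) n = m c.

Lemma logn_orbit p : logn (val p) n = m (porbit sigma p).
Proof. by apply: Hm; [apply: imset_f|apply: porbit_id]. Qed.

Lemma oexpo_le v c : aut v = v -> c \in porbits sigma -> (oexpo v c <= m c)%N.
Proof.
by move=> vfix /imsetP [p _ ->]; rewrite oexpoE // -logn_orbit expo_le.
Qed.

(** A fixed factor amounts to a family of exponents, one for each orbit: the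
    fixed subposet is a product of chains. *)
Lemma sum_fixed (R : comNzRingType) (g : {set prime_factor n} -> nat -> R) w :
  aut w = w ->
  \sum_(v | (aut v == v) && (w <= v)%O) \prod_(c in porbits sigma) g c (oexpo v c) =
  \prod_(c in porbits sigma) \sum_(oexpo w c <= a < (m c).+1) g c a.
Proof.
move=> wfix; pose N := (\max_(c in porbits sigma) m c)%N.
have mN c : c \in porbits sigma -> (m c <= N)%N by move=> cO; apply: leq_bigmax_cond.
rewrite [RHS](eq_bigr (fun c => \sum_(a < N.+1 | (oexpo w c <= a <= m c)%N) g c a)); last first.
  move=> c cO; rewrite -(big_mkord (fun a => (oexpo w c <= a <= m c)%N) (g c)).
  rewrite [LHS](big_nat_widen _ _ N.+1) ?ltnS ?mN // [LHS](big_nat_widenl _ 0) //.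
  by apply: eq_bigl => a; rewrite /= ltnS andbC.
rewrite (big_distr_big_dep ord0).
(* On the families summed over, the minimum is [f (porbit sigma p)]. *)
pose ex (f : {ffun {set prime_factor n} -> 'I_N.+1}) p :=
  minn (f (porbit sigma p)) (logn (val p) n).
have ex_le f p : (ex f p <= logn (val p) n)%N by apply: geq_minr.
pose fac f : factor n :=
  SeqSub (prod_dvd (ex_le f) : (_ : natdvd) \in (divisors n : seq natdvd)).
pose coo v : {ffun {set prime_factor n} -> 'I_N.+1} :=
  [ffun c => if c \in porbits sigma then inord (oexpo v c) else ord0].
have expo_fac f p : expo (fac f) p = ex f p by apply: logn_prod.
have fac_fixed f : aut (fac f) = fac f.
  apply/eqP/fixedP => p; rewrite !expo_fac /ex Hsigma.
  by rewrite (_ : porbit sigma (sigma p) = porbit sigma p) //; apply/eqP;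
    rewrite eq_porbit_mem -{1}[sigma]expg1 mem_porbit.
have oexpo_fac f c : c \in porbits sigma -> oexpo (fac f) c = minn (f c) (m c).
  by move=> /imsetP [p _ ->]; rewrite oexpoE // expo_fac /ex -logn_orbit.
rewrite (reindex_onto fac coo) /=; last first.
  move=> v /andP[/eqP vfix _]; apply: expo_inj => p.
  rewrite expo_fac /ex ffunE imset_f // oexpoE // inordK.
    by apply/minn_idPl; apply: expo_le.
  by rewrite ltnS (leq_trans (expo_le v p)) // logn_orbit mN // imset_f.
apply: eq_big => [f|f /andP[_ /eqP fE]]; last first.
  apply: eq_bigr => c cO; congr (g c _).
  have := congr1 (fun h : {ffun _ -> _} => nat_of_ord (h c)) fE.
  rewrite /= ffunE cO inordK // ltnS.
  by apply: leq_trans (mN c cO); apply: oexpo_le.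
rewrite fac_fixed eqxx /=; apply/andP/pfamilyP => [[wf /eqP fE]|[f_supp fQ]].
  split=> [|c cO].
    apply/subsetP => c; rewrite inE; apply: contraR => cO.
    by rewrite -fE ffunE (negPf cO).
  have fc : (f c : nat) = oexpo (fac f) c.
    rewrite -{1}fE ffunE cO inordK // ltnS.
    by apply: leq_trans (mN c cO); apply: oexpo_le.
  rewrite unfold_in /= fc oexpo_le // andbT.
  case/imsetP: cO => p _ ->; rewrite !oexpoE //.
  by move/factor_leP: wf; apply.
have fm c : c \in porbits sigma -> (oexpo w c <= f c <= m c)%N by move/fQ.
split.
  apply/factor_leP => p; have pO : porbit sigma p \in porbits sigma by apply: imset_f.
  have /andP[h1 h2] := fm _ pO.
  by rewrite expo_fac /ex logn_orbit -(oexpoE _ wfix) (minn_idPl h2).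
apply/eqP/ffunP => c; rewrite ffunE; case: ifP => [cO|/negbT cO].
  have /andP[_ h] := fm c cO.
  by apply: val_inj; rewrite /= oexpo_fac // (minn_idPl h) inordK.
apply/esym/eqP; apply: contraR cO => fc; apply: (subsetP f_supp).
by rewrite inE.
Qed.

Lemma telescope_chain (R : comNzRingType) (z : R) (o t : nat) : (o <= t)%N ->
  \sum_(o <= a < t.+1) (if (a < t)%N then 1 - z else 1) * z ^+ (a - o) = 1.
Proof.
move=> ot; rewrite -(subnKC ot); move: (t - o)%N => k {ot}.
rewrite big_nat_recr ?leq_addr //= ltnn mul1r big_nat_cond.
rewrite (eq_bigr (fun a => z ^+ (a - o) - z ^+ (a.+1 - o))); last first.
  by move=> a /andP[/andP[oa ->] _]; rewrite mulrBl mul1r -exprS subSn.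
rewrite -big_nat_cond; elim: k => [|k IHk].
  by rewrite addn0 big_geq // subnn add0r.
by rewrite addnS big_nat_recr ?leq_addr //= -addrA subrK IHk.
Qed.

Section OrbitWeights.
Variable F : fieldType.

(** The sums of values of the Moebius function that [graded_trace] requires are
    multiplicative; on the chain of exponents of an orbit [c], a step has rank
    difference [#|c|], and the sum is [1 - 'X^#|c|] except at the top. *)
Definition orbit_weight v : {poly F} := \prod_(c in porbits sigma)
  (if (oexpo v c < m c)%N then 1 - 'X^#|c| else 1).

Lemma orbit_weightP w : aut w = w ->
  \sum_(v | (aut v == v) && (w <= v)%O)
    orbit_weight v * 'X^(rank v - rank w) = 1.
Proof.
move=> wfix; pose g c a : {poly F} :=
  (if (a < m c)%N then 1 - 'X^#|c| else 1) * 'X^#|c| ^+ (a - oexpo w c).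
rewrite (eq_bigr (fun v => \prod_(c in porbits sigma) g c (oexpo v c))).
  rewrite sum_fixed // big1 // => c cO; apply: telescope_chain.
  exact: oexpo_le.
move=> v /andP[/eqP vfix wv]; rewrite big_split /=; congr (_ * _).
rewrite !rank_fixed // -sumnB; last first.
  move=> _ /imsetP [p _ ->]; rewrite !oexpoE // leq_mul2l.
  by move/factor_leP: wv => ->; rewrite orbT.
rewrite -prodrXr; apply: eq_bigr => c _.
by rewrite -mulnBr exprM.
Qed.

Lemma sum_orbit_weight : \sum_(v | aut v == v) orbit_weight v =
  \prod_(c in porbits sigma) (1 + (m c)%:R * (1 - 'X^#|c|)).
Proof.
have fix1 : aut factor1 = factor1 by apply: (aut_bot factor1_le).
rewrite (eq_bigl (fun v => (aut v == v) && (factor1 <= v)%O)); last first.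
  by move=> v; rewrite factor1_le andbT.
rewrite (sum_fixed (fun c a => if (a < m c)%N then 1 - 'X^#|c| else 1) fix1).
apply: eq_bigr => c cO; have -> : oexpo factor1 c = 0%N.
  by case/imsetP: cO => p _ ->; rewrite oexpoE // /expo logn1.
rewrite big_nat_recr //= ltnn addrC; congr (_ + _).
rewrite big_nat_cond (eq_bigr (fun=> 1 - 'X^#|c|)); last first.
  by move=> a /andP[/andP[_ ->]].
by rewrite -big_nat_cond sumr_const_nat subn0 mulr_natl.
Qed.

End OrbitWeights.

End FixedFactors.

Theorem theorem7p2 (F : fieldType) (n : nat) (n_gt0 : (0 < n)%N)
    (sigma : {perm prime_factor n})
    (Hsigma : preserves_multiplicity sigma)
    (m : {set prime_factor n} -> nat)
    (Hm : forall (c : {set prime_factor n}) (p : prime_factor n),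
        c \in porbits sigma -> p \in c -> logn (val p) n = m c) :
  has_graded_trace (splitting_piece F (factor n))
    (splitting_aut (factor_aut Hsigma))
    (series_div (1 - 'X)
       (1 - 'X * \prod_(c in porbits sigma) (1 + (m c)%:R * (1 - 'X^#|c|)))).
Proof.
rewrite -(sum_orbit_weight n_gt0 Hsigma Hm F).
apply: (@graded_trace F _ (factor n) _ (@factor1_le n)) => w wfix.
exact: (orbit_weightP n_gt0 Hm F wfix).
Qed.
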